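(* Let $\mathcal G$ be a finite simplicial graph with vertex set $I$, let $(G_i)_{i\in I}$ be finite groups, let $\Gamma=\Gamma(\mathcal G,(G_i)_{i\in I})$ be the graph product and $\Delta=\Delta(\mathcal G,(G_i)_{i\in I})$ the associated right-angled building. A uniform lattice $\Gamma'\subset\mathrm{Aut}_0(\Delta)$ is commensurable to $\Gamma$ in $\mathrm{Aut}_0(\Delta)$ if and only if $\Gamma'$ has a finite index subgroup with trivial holonomy.
   Context: Graph product: $\Gamma(\mathcal G,(G_i))$ is the quotient of the free product $\ast_{i\in I}G_i$ by the normal subgroup generated by all commutators $g_ig_jg_i^{-1}g_j^{-1}$, $g_i\in G_i$, $g_j\in G_j$, with $i\ne j$ adjacent in $\mathcal G$. For $J\subset I$, $\Gamma_J$ is the subgroup of $\Gamma$ generated by the $G_j$, $j\in J$ (so $\Gamma_\emptyset=1$). Building: call $\sigma\subset I$ spherical if its elements are pairwise adjacent (the empty set and singletons included). In the real Hilbert space with orthonormal basis $(e_i)_{i\in I}$ let $C$ be the cube complex that is the union over finite spherical $\sigma$ of the unit cubes $\{\sum_{i\in\sigma}x_ie_i: 0\le x_i\le 1\}$ (together with their faces). Its vertices are $v_J=\sum_{i\in J}e_i$, $J$ finite spherical. For $x\in C$ put $\underline t(x)=\{i: x_i=1\}$. Then $\Delta=(\Gamma\times C)/\sim$ where $(\gamma,x)\sim(\gamma',x')$ iff $x=x'$ and $\gamma^{-1}\gamma'\in\Gamma_{\underline t(x)}$, with the cube complex structure whose cubes are the images of the sets $\{\gamma\}\times Q$, $Q$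 a cube of $C$. The type of the vertex $[\gamma,v_J]$ is $J$. The chambers of $\Delta$ are the images of the sets $\{\gamma\}\times C$, $\gamma\in\Gamma$. $\mathrm{Aut}_0(\Delta)$ is the group of combinatorial automorphisms of $\Delta$ preserving types of vertices. $\Gamma$ acts on $\Delta$ by left multiplication, faithfully, and is regarded as a subgroup of $\mathrm{Aut}_0(\Delta)$. Residues and holonomy: for a cube $Q$ of $\Delta$, $t(Q)$ is the largest of the types of its vertices. Two chambers are $i$-adjacent if their intersection contains a vertex of type $\{i\}$. For $J\subset I$ and a chamber $D$, the $J$-residue $R(J,D)$ is the union of the cubes $Q$ with $t(Q)\subset J$ that lie in a chamber $D'$ which can be joined to $D$ by a finite sequence of chambers in which consecutive ones are $j$-adjacent for some $j\in J$. For $i\in I$ let $i^{\underline\perp}$ be the set consisting of $i$ and all vertices adjacent to $i$. The $i$-boundary $\partial_iR$ of a residue $R$ is the union of the cubes $Q$ of $R$ with $i\notin t(Q)$. For a subgroup $G\subset\mathrm{Aut}_0(\Delta)$, $i\in I$ and an $i^{\underline\perp}$-residue $R$, the $i$-holonomy of $G$ at $R$ is the morphism from the stabilizer $G_R=\{g\in G: gR=R\}$ to the permutation group of $\pi_0(\partial_iR)$. $G$ has trivial holonomy (no holonomy) if for every $i\in I$ and every $i^{\underline\perp}$-residue $R$ this morphism is trivial. A uniform lattice is a subgroup of $\mathrm{Aut}_0(\Delta)$ with finite vertex stabilizers and finitely many orbits of vertices. Subgroups $\Gamma_1,\Gamma_2$ of a group $G$ are commensurable in $G$ if for some $g\in G$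 the group $g\Gamma_1g^{-1}\cap\Gamma_2$ has finite index in both $g\Gamma_1g^{-1}$ and $\Gamma_2$. *)

(* Defs.v *)
From HB Require Import structures.
From Stdlib Require Import Relation_Operators.
From mathcomp Require Import all_boot all_order all_fingroup all_algebra.
From mathcomp Require Import all_classical all_reals all_analysis.

Set Implicit Arguments.
Unset Strict Implicit.
Unset Printing Implicit Defensive.

Import Order.TTheory GRing.Theory Num.Theory.
Import numFieldNormedType.Exports.

Local Open Scope ring_scope.
Local Open Scope group_scope.
Local Open Scope classical_set_scope.
Local Open Scope quotient_scope.

(* fingroup also has a function named repr. *)
Local Notation qrepr := generic_quotient.repr.

Section Subgroups.
Variable G : groupType.
Implicit Types (A H K : set G).

Definition is_subgroup H : Prop :=
  [/\ H 1, forall x y, H x -> H y -> H (x * y) & forall x, H x -> H x^-1].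

Definition is_normal_subgroup H : Prop :=
  is_subgroup H /\ forall g x, H x -> H (g * x * g^-1).

Definition generated_by A : set G := smallest is_subgroup A.

Definition normal_closure A : set G := smallest is_normal_subgroup A.

Definition left_coset (x : G) K : set G := [set x * k | k in K].

Definition finite_index K H : Prop :=
  K `<=` H /\ finite_set [set left_coset x K | x in H].

Definition conj_by (g : G) H : set G := [set g * h * g^-1 | h in H].

Definition commensurable H K : Prop :=
  exists g, let L := conj_by g H `&` K in
    finite_index L (conj_by g H) /\ finite_index L K.

Lemma generated_by_subgroup A : is_subgroup (generated_by A).
Proof.
split=> [H [[] //]|x y Ax Ay H sAH|x Ax H sAH].
- by case: (sAH) => -[_ + _] _; apply; [apply: Ax|apply: Ay].
- by case: (sAH) => -[_ _ +] _; apply; apply: Ax.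
Qed.

Lemma normal_closure_normal A : is_normal_subgroup (normal_closure A).
Proof.
split; first split=> [H [[[] //]]|x y Ax Ay H sAH|x Ax H sAH].
- by case: (sAH) => -[[_ + _] _] _; apply; [apply: Ax|apply: Ay].
- by case: (sAH) => -[[_ _ +] _] _; apply; apply: Ax.
- by move=> g x Ax H sAH; case: (sAH) => -[_ +] _; apply; apply: Ax.
Qed.

End Subgroups.

Section NormalQuotient.
Variables (G : groupType) (A : set G).

Definition ncl_rel : rel G := fun x y => `[< normal_closure A (x^-1 * y) >].

Lemma ncl_refl : reflexive ncl_rel.
Proof.
by move=> x; apply/asboolP; rewrite mulVg; case: (normal_closure_normal A) => -[].
Qed.

Lemma ncl_sym : symmetric ncl_rel.
Proof.
have [[_ _ NV] _] := normal_closure_normal A.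
move=> x y; apply/asboolP/asboolP => /NV; by rewrite invgM invgK.
Qed.

Lemma ncl_trans : transitive ncl_rel.
Proof.
have [[_ NM _] _] := normal_closure_normal A.
move=> y x z /asboolP xy /asboolP yz; apply/asboolP.
by have := NM _ _ xy yz; rewrite mulgA mulgK.
Qed.

Canonical ncl_equiv := EquivRel ncl_rel ncl_refl ncl_sym ncl_trans.

(* The quotient of G by the normal closure of A. *)
Definition normal_quotient : Type := {eq_quot ncl_equiv}.

HB.instance Definition _ := Choice.on normal_quotient.
HB.instance Definition _ := EqQuotient.on normal_quotient.

Local Notation Q := normal_quotient.

Lemma nq_eqP (x y : G) :
  reflect (normal_closure A (x^-1 * y)) (\pi_Q x == \pi_Q y).
Proof. by rewrite piE; apply: asboolP. Qed.

Definition nq_one : Q := \pi_Q 1.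
Definition nq_mul (a b : Q) : Q := \pi_Q (qrepr a * qrepr b).
Definition nq_inv (a : Q) : Q := \pi_Q (qrepr a)^-1.

Lemma nq_reprP (x : G) : normal_closure A (x^-1 * qrepr (\pi_Q x)).
Proof. by apply/nq_eqP; rewrite reprK. Qed.

Lemma nq_mulE x y : nq_mul (\pi_Q x) (\pi_Q y) = \pi_Q (x * y).
Proof.
have [[_ NM NV] NJ] := normal_closure_normal A.
apply/esym/eqP/nq_eqP.
have := NM _ _ (NJ y^-1 _ (nq_reprP x)) (nq_reprP y).
by rewrite invgK invgM !mulgA mulgK.
Qed.

Lemma nq_invE x : nq_inv (\pi_Q x) = \pi_Q x^-1.
Proof.
have [[_ NM NV] NJ] := normal_closure_normal A.
apply/esym/eqP/nq_eqP; rewrite invgK.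
have := NJ x _ (NV _ (nq_reprP x)).
by rewrite invgM invgK !mulgA mulgK.
Qed.

Lemma nq_mulA : associative nq_mul.
Proof.
elim/quotW=> x; elim/quotW=> y; elim/quotW=> z.
by rewrite (nq_mulE x y) (nq_mulE y z) !nq_mulE mulgA.
Qed.

Lemma nq_mul1 : left_id nq_one nq_mul.
Proof. by elim/quotW=> x; rewrite /nq_one nq_mulE mul1g. Qed.

Lemma nq_mulr1 : right_id nq_one nq_mul.
Proof. by elim/quotW=> x; rewrite /nq_one nq_mulE mulg1. Qed.

Lemma nq_mulV : left_inverse nq_one nq_inv nq_mul.
Proof. by elim/quotW=> x; rewrite nq_invE nq_mulE mulVg. Qed.

Lemma nq_mulrV : right_inverse nq_one nq_inv nq_mul.
Proof. by elim/quotW=> x; rewrite nq_invE nq_mulE mulgV. Qed.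

HB.instance Definition _ :=
  isGroup.Build Q nq_mulA nq_mul1 nq_mulr1 nq_mulV nq_mulrV.

End NormalQuotient.

Section FreeProduct.
Variables (I : finType) (G : I -> finGroupType).

Definition word : Type := seq {i : I & G i}.
HB.instance Definition _ := Choice.on word.

Definition letter (i : I) (g : G i) : {i : I & G i} := existT _ i g.

(* Two words represent the same element of the free product iff they are
   related by the least congruence compatible with the products of the G i. *)
Inductive free_eq : word -> word -> Prop :=
| free_eq_refl u : free_eq u u
| free_eq_sym u v : free_eq u v -> free_eq v u
| free_eq_trans u v w : free_eq u v -> free_eq v w -> free_eq u w
| free_eq_cat u u' v v' :
    free_eq u u' -> free_eq v v' -> free_eq (u ++ v) (u' ++ v')
| free_eq_one i : free_eq [:: letter (1 : G i)] [::]
| free_eq_mul i (g h : G i) :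
    free_eq [:: letter g; letter h] [:: letter (g * h)].

Definition free_rel : rel word := fun u v => `[< free_eq u v >].

Lemma free_rel_refl : reflexive free_rel.
Proof. by move=> u; apply/asboolP; apply: free_eq_refl. Qed.

Lemma free_rel_sym : symmetric free_rel.
Proof. by move=> u v; apply/asboolP/asboolP; apply: free_eq_sym. Qed.

Lemma free_rel_trans : transitive free_rel.
Proof.
by move=> v u w /asboolP uv /asboolP vw; apply/asboolP; apply: free_eq_trans vw.
Qed.

Canonical free_equiv := EquivRel free_rel free_rel_refl free_rel_sym free_rel_trans.

Definition free_product : Type := {eq_quot free_equiv}.

HB.instance Definition _ := Choice.on free_product.
HB.instance Definition _ := EqQuotient.on free_product.

Local Notation F := free_product.

Lemma fp_eqP (u v : word) : reflect (free_eq u v) (\pi_F u == \pi_F v).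
Proof. by rewrite piE; apply: asboolP. Qed.

Lemma fp_reprP (u : word) : free_eq u (qrepr (\pi_F u)).
Proof. by apply/fp_eqP; rewrite reprK. Qed.

Definition word_inv (u : word) : word :=
  rev [seq letter (tagged l)^-1 | l : {i : I & G i} <- u].

Lemma word_invV (u : word) : free_eq (word_inv u ++ u) [::].
Proof.
elim: u => [|[i g] u IH]; first exact: free_eq_refl.
rewrite /word_inv /= rev_cons -cats1 -catA.
apply: free_eq_trans IH; apply: free_eq_cat; first exact: free_eq_refl.
rewrite -[X in free_eq _ X]cat0s -[(letter _ :: u)]cat1s catA.
apply: free_eq_cat; last exact: free_eq_refl.
apply: free_eq_trans (free_eq_mul _ _) _.
by rewrite mulVg; apply: free_eq_one.
Qed.

Lemma word_invrV (u : word) : free_eq (u ++ word_inv u) [::].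
Proof.
elim/last_ind: u => [|u [i g] IH]; first exact: free_eq_refl.
rewrite /word_inv map_rcons rev_rcons -cats1 -catA.
apply: free_eq_trans IH; apply: free_eq_cat; first exact: free_eq_refl.
rewrite -[X in free_eq _ X]cat0s -[X in _ ++ X]cat1s catA.
apply: free_eq_cat; last exact: free_eq_refl.
apply: free_eq_trans (free_eq_mul _ _) _.
by rewrite mulgV; apply: free_eq_one.
Qed.

Definition fp_one : F := \pi_F [::].
Definition fp_mul (a b : F) : F := \pi_F (qrepr a ++ qrepr b).
Definition fp_inv (a : F) : F := \pi_F (word_inv (qrepr a)).

Lemma fp_mulE u v : fp_mul (\pi_F u) (\pi_F v) = \pi_F (u ++ v).
Proof.
by apply/esym/eqP/fp_eqP; apply: free_eq_cat; apply: fp_reprP.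
Qed.

Lemma fp_mulA : associative fp_mul.
Proof.
elim/quotW=> x; elim/quotW=> y; elim/quotW=> z.
by rewrite (fp_mulE x y) (fp_mulE y z) !fp_mulE catA.
Qed.

Lemma fp_mul1 : left_id fp_one fp_mul.
Proof. by elim/quotW=> x; rewrite /fp_one fp_mulE. Qed.

Lemma fp_mulr1 : right_id fp_one fp_mul.
Proof. by elim/quotW=> x; rewrite /fp_one fp_mulE cats0. Qed.

Lemma fp_mulV : left_inverse fp_one fp_inv fp_mul.
Proof.
move=> a; rewrite -{2}[a]reprK /fp_inv fp_mulE.
by apply/eqP/fp_eqP; apply: word_invV.
Qed.

Lemma fp_mulrV : right_inverse fp_one fp_inv fp_mul.
Proof.
move=> a; rewrite -{1}[a]reprK /fp_inv fp_mulE.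
by apply/eqP/fp_eqP; apply: word_invrV.
Qed.

HB.instance Definition _ :=
  isGroup.Build F fp_mulA fp_mul1 fp_mulr1 fp_mulV fp_mulrV.

Definition fp_in (i : I) (g : G i) : F := \pi_F [:: letter g].

End FreeProduct.

Section GraphProduct.
Variables (I : finType) (e : rel I) (G : I -> finGroupType).

Definition graph_commutators : set (free_product G) :=
  [set x | exists i j (g : G i) (h : G j), [/\ i != j, e i j &
     x = fp_in g * fp_in h * (fp_in g)^-1 * (fp_in h)^-1]].

Definition graph_product : groupType := normal_quotient graph_commutators.

Definition gp_in (i : I) (g : G i) : graph_product :=
  \pi_(normal_quotient graph_commutators) (fp_in g).

(* Gamma_J *)
Definition special_subgroup (J : {set I}) : set graph_product :=
  generated_by (\bigcup_(j in [set j | j \in J]) range (@gp_in j)).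

Definition spherical (J : {set I}) : bool :=
  [forall i in J, forall j in J, (i != j) ==> e i j].

End GraphProduct.

Section Building.
Variables (R : realType) (I : finType) (e : rel I) (G : I -> finGroupType).

Local Notation Gamma := (graph_product e G).

(* As I is finite, the Hilbert space with orthonormal basis (e_i) is R^I, with
   the product topology and the Euclidean distance. *)
Definition euclidean : topologicalType := {ptws I -> R}.

Definition euclidean_dist (x y : euclidean) : R :=
  Num.sqrt (\sum_i (x i - y i) ^+ 2)%R.

Definition unit_cube (s : {set I}) : set euclidean :=
  [set x | forall i, (0 <= x i <= 1)%R /\ (i \notin s -> x i = 0%R)].

Definition model_space : set euclidean :=
  \bigcup_(s in [set s : {set I} | spherical e s]) unit_cube s.

Definition model : topologicalType := set_type model_space.

Definition coordinate (x : model) (i : I) : R := set_val x i.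

(* The faces of the unit cube on s are obtained by choosing the coordinates
   that are free (those in B but not in A), those equal to 1 (in A), and those
   equal to 0 (not in B), where A \subset B \subset s. *)
Definition face (A B : {set I}) : set model :=
  [set x | forall i, [/\ (0 <= coordinate x i <= 1)%R, i \in A -> coordinate x i = 1%R &
                        i \notin B -> coordinate x i = 0%R]].

Definition model_cube : set (set model) :=
  [set P | exists A B : {set I}, [/\ A \subset B, spherical e B & P = face A B]].

(* x is the vertex v_J of the model. *)
Definition is_model_vertex (J : {set I}) (x : model) : Prop :=
  forall i, coordinate x i = (i \in J)%:R%R.

Definition tbar (x : model) : {set I} := [set i | coordinate x i == 1%R]%SET.

Definition prebuilding : topologicalType :=
  (discrete_topology Gamma * model)%type.

Definition building_rel : rel prebuilding := fun p q =>
  `[< p.2 = q.2 /\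
      special_subgroup (tbar p.2) ((p.1 : Gamma)^-1 * (q.1 : Gamma)) >].

Lemma building_rel_refl : reflexive building_rel.
Proof.
move=> p; apply/asboolP; split=> //; rewrite mulVg.
by case: (generated_by_subgroup (\bigcup_(j in [set j | j \in tbar p.2])
  range (@gp_in I e G j))).
Qed.

Lemma building_rel_sym : symmetric building_rel.
Proof.
have sym p q : building_rel p q -> building_rel q p.
  move=> /asboolP[pq Jpq]; apply/asboolP; split=> //; rewrite -pq.
  have [_ _ /(_ _ Jpq)] := generated_by_subgroup
    (\bigcup_(j in [set j | j \in tbar p.2]) range (@gp_in I e G j)).
  by rewrite invgM invgK.
by move=> p q; apply/idP/idP; apply: sym.
Qed.

Lemma building_rel_trans : transitive building_rel.
Proof.
move=> q p r /asboolP[pq Jpq] /asboolP[qr Jqr]; apply/asboolP.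
split; first by rewrite pq.
rewrite -pq in Jqr.
have [_ /(_ _ _ Jpq Jqr) + _] := generated_by_subgroup
  (\bigcup_(j in [set j | j \in tbar p.2]) range (@gp_in I e G j)).
by rewrite mulgA mulgK.
Qed.

Canonical building_equiv :=
  EquivRel building_rel building_rel_refl building_rel_sym building_rel_trans.

(* Delta, with the quotient topology; Gamma is discrete. *)
Definition building : topologicalType :=
  quotient_topology {eq_quot building_equiv}.

(* [pt gamma x] is the point [gamma, x] of Delta. *)
Definition pt (gamma : Gamma) (x : model) : building :=
  \pi_({eq_quot building_equiv}) ((gamma, x) : prebuilding).

Lemma ptP (gamma gamma' : Gamma) (x x' : model) :
  pt gamma x = pt gamma' x' <->
  x = x' /\ special_subgroup (tbar x) (gamma^-1 * gamma').
Proof.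
split=> [/(eqmodP building_equiv)/asboolP//|xx'].
exact/(eqmodP building_equiv)/asboolP.
Qed.

Lemma pt_surj (p : building) : exists gamma x, p = pt gamma x.
Proof.
exists (qrepr (p : {eq_quot building_equiv})).1.
exists (qrepr (p : {eq_quot building_equiv})).2.
by rewrite /pt -surjective_pairing reprK.
Qed.

Definition is_cube : set (set building) :=
  [set Q | exists gamma P, model_cube P /\ Q = pt gamma @` P].

Definition is_chamber : set (set building) :=
  [set D | exists gamma, D = range (pt gamma)].

Definition vertex_of_type (J : {set I}) : set building :=
  [set p | exists gamma x, is_model_vertex J x /\ p = pt gamma x].

Definition is_vertex : set building := \bigcup_J vertex_of_type J.

(* A map is combinatorial if it sends each cube onto a cube by an isometry for
   the coordinates of the two cubes. *)
Definition combinatorial (f : building -> building) : Prop :=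
  forall gamma P, model_cube P ->
    exists gamma' P' (phi : model -> model),
      [/\ model_cube P', set_bij P P' phi,
          {in P &, forall x y,
            euclidean_dist (set_val (phi x)) (set_val (phi y)) =
            euclidean_dist (set_val x) (set_val y)} &
          {in P, forall x, f (pt gamma x) = pt gamma' (phi x)}].

Definition type_preserving (f : building -> building) : Prop :=
  forall J p, vertex_of_type J p -> vertex_of_type J (f p).

Record Aut0 := MkAut0 {
  aut_fun :> building -> building;
  aut_inv : building -> building;
  aut_funK : cancel aut_fun aut_inv;
  aut_invK : cancel aut_inv aut_fun;
  aut_fun_comb : combinatorial aut_fun;
  aut_inv_comb : combinatorial aut_inv;
  aut_fun_type : type_preserving aut_fun;
  aut_inv_type : type_preserving aut_inv }.

HB.instance Definition _ := gen_eqMixin Aut0.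
HB.instance Definition _ := gen_choiceMixin Aut0.

Lemma aut0_ext (f g : Aut0) : f =1 g -> f = g.
Proof.
case: f g => [f fi fK fiK fc fic ft fit] [g gi gK giK gc gic gt git] /= fg.
have Efg : f = g by apply/funext.
have Ei : fi = gi.
  by apply/funext => p; rewrite -[RHS]fK fg giK.
subst g gi; congr MkAut0; exact: Prop_irrelevance.
Qed.

Lemma combinatorial_id : combinatorial id.
Proof.
move=> gamma P P_cube; exists gamma, P, id; split=> //.
by split=> // x Px; exists x.
Qed.

Lemma combinatorial_comp f g :
  combinatorial f -> combinatorial g -> combinatorial (f \o g).
Proof.
move=> fc gc gamma P P_cube.
have [gamma' [P' [phi [P'_cube phi_bij phi_iso phiE]]]] := gc gamma P P_cube.
have [gamma2 [P2 [psi [P2_cube psi_bij psi_iso psiE]]]] := fc gamma' P' P'_cube.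
have phiP x : x \in P -> phi x \in P'.
  by rewrite !inE; case: phi_bij => + _ _; apply.
exists gamma2, P2, (psi \o phi); split=> //.
- exact: set_bij_comp phi_bij psi_bij.
- by move=> x y Px Py /=; rewrite psi_iso ?phiP// phi_iso.
- by move=> x Px /=; rewrite phiE// psiE ?phiP.
Qed.

Definition aut_one : Aut0 :=
  @MkAut0 id id (fun _ => erefl) (fun _ => erefl) combinatorial_id
    combinatorial_id (fun _ _ => id) (fun _ _ => id).

Definition aut_mul (f g : Aut0) : Aut0 :=
  @MkAut0 (f \o g) (aut_inv g \o aut_inv f)
    (can_comp (aut_funK f) (aut_funK g)) (can_comp (aut_invK g) (aut_invK f))
    (combinatorial_comp (aut_fun_comb f) (aut_fun_comb g))
    (combinatorial_comp (aut_inv_comb g) (aut_inv_comb f))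
    (fun J p Jp => aut_fun_type f (aut_fun_type g Jp))
    (fun J p Jp => aut_inv_type g (aut_inv_type f Jp)).

Definition aut_V (f : Aut0) : Aut0 :=
  @MkAut0 (aut_inv f) f (aut_invK f) (aut_funK f) (aut_inv_comb f)
    (aut_fun_comb f) (aut_inv_type f) (aut_fun_type f).

Lemma aut_mulA : associative aut_mul.
Proof. by move=> f g h; apply: aut0_ext. Qed.

Lemma aut_mul1 : left_id aut_one aut_mul.
Proof. by move=> f; apply: aut0_ext. Qed.

Lemma aut_mulr1 : right_id aut_one aut_mul.
Proof. by move=> f; apply: aut0_ext. Qed.

Lemma aut_mulV : left_inverse aut_one aut_V aut_mul.
Proof. by move=> f; apply: aut0_ext => p; apply: aut_funK. Qed.

Lemma aut_mulrV : right_inverse aut_one aut_V aut_mul.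
Proof. by move=> f; apply: aut0_ext => p; apply: aut_invK. Qed.

HB.instance Definition _ :=
  isGroup.Build Aut0 aut_mulA aut_mul1 aut_mulr1 aut_mulV aut_mulrV.

Definition left_act (gamma : Gamma) (p : building) : building :=
  let q := qrepr (p : {eq_quot building_equiv}) in
  pt (gamma * (q.1 : Gamma)) q.2.

Lemma left_actE gamma delta x : left_act gamma (pt delta x) = pt (gamma * delta) x.
Proof.
rewrite /left_act; set q := qrepr _.
have : pt q.1 q.2 = pt delta x by rewrite /pt -surjective_pairing reprK.
move=> /ptP[qx Jq]; apply/ptP; split=> //.
by rewrite invgM mulgA -[_ * gamma]mulgA mulVg mulg1.
Qed.

Lemma left_actK gamma : cancel (left_act gamma) (left_act gamma^-1).
Proof.
by move=> p; have [d [x ->]] := pt_surj p; rewrite !left_actE mulgA mulVg mul1g.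
Qed.

Lemma left_actVK gamma : cancel (left_act gamma^-1) (left_act gamma).
Proof. by move=> p; rewrite -{1}[gamma]invgK left_actK. Qed.

Lemma left_act_comb gamma : combinatorial (left_act gamma).
Proof.
move=> delta P P_cube; exists (gamma * delta), P, id; split=> //.
  by split=> // x Px; exists x.
by move=> x _; rewrite left_actE.
Qed.

Lemma left_act_type gamma : type_preserving (left_act gamma).
Proof.
move=> J _ [delta [x [Jx ->]]]; exists (gamma * delta), x; split=> //.
exact: left_actE.
Qed.

Definition left_aut (gamma : Gamma) : Aut0 :=
  @MkAut0 _ _ (left_actK gamma) (left_actVK gamma) (left_act_comb gamma)
    (left_act_comb _) (left_act_type gamma) (left_act_type _).

Definition Gamma_in_Aut0 : set Aut0 := range left_aut.

Definition vertex_stabilizer (L : set Aut0) (p : building) : set Aut0 :=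
  [set g | L g /\ g p = p].

Definition orbit_of (L : set Aut0) (p : building) : set building :=
  [set (g : Aut0) p | g in L].

Definition uniform_lattice (L : set Aut0) : Prop :=
  [/\ is_subgroup L,
      forall p, is_vertex p -> finite_set (vertex_stabilizer L p) &
      finite_set [set orbit_of L p | p in is_vertex]].

Definition is_largest_type (Q : set building) (J : {set I}) : Prop :=
  (exists2 p, Q p & vertex_of_type J p) /\
  forall K p, Q p -> vertex_of_type K p -> K \subset J.

(* t(Q) *)
Definition cube_type (Q : set building) : {set I} :=
  xget finset.set0 [set J | is_largest_type Q J].

Definition adjacent_chambers (i : I) (D D' : set building) : Prop :=
  D `&` D' `&` vertex_of_type [set i]%SET !=set0.

Definition joined (J : {set I}) : set building -> set building -> Prop :=
  clos_refl_trans (set building) (fun D D' => [/\ is_chamber D, is_chamber D' &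
    exists2 j, j \in J & adjacent_chambers j D D']).

Definition residue (J : {set I}) (D : set building) : set building :=
  \bigcup_(Q in [set Q | [/\ is_cube Q, cube_type Q \subset J &
                        exists2 D', joined J D D' & Q `<=` D']]) Q.

Definition is_residue (J : {set I}) (X : set building) : Prop :=
  exists2 D, is_chamber D & X = residue J D.

(* i together with its link; this contains i, unlike the usual i^perp. *)
Definition perp (i : I) : {set I} := [set j | (j == i) || e i j]%SET.

Definition i_boundary (i : I) (X : set building) : set building :=
  \bigcup_(Q in [set Q | [/\ is_cube Q, Q `<=` X & i \notin cube_type Q]]) Q.

Definition pi0 (Y : set building) : set (set building) :=
  [set connected_component Y p | p in Y].

Definition residue_stabilizer (L : set Aut0) (X : set building) : set Aut0 :=
  [set g | L g /\ (g : Aut0) @` X = X].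

(* An element g of the stabilizer of X permutes the components of the
   i-boundary of X by K |-> g @` K; the holonomy at X is this action. *)
Definition trivial_holonomy_at (L : set Aut0) (i : I) (X : set building) : Prop :=
  forall g, residue_stabilizer L X g ->
    forall K, pi0 (i_boundary i X) K -> (g : Aut0) @` K = K.

Definition trivial_holonomy (L : set Aut0) : Prop :=
  forall i X, is_residue (perp i) X -> trivial_holonomy_at L i X.

End Building.

Arguments Gamma_in_Aut0 R {I} e G.

(* Main.v *)
Require Import Defs.
From Stdlib Require Import Relation_Operators.
From mathcomp Require Import all_boot all_order all_fingroup all_algebra.
From mathcomp Require Import all_classical all_reals all_analysis.
From mathcomp Require Import lra.

Set Implicit Arguments.
Unset Strict Implicit.
Unset Printing Implicit Defensive.

Import Order.TTheory GRing.Theory Num.Theory.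
Import numFieldNormedType.Exports.

Local Open Scope ring_scope.
Local Open Scope group_scope.
Local Open Scope classical_set_scope.
Local Open Scope quotient_scope.

(** Automorphisms correspond to permutations of the chambers, i.e. of Gamma,
    that preserve i-adjacency for all i. On chambers, a group H has trivial
    holonomy iff [f a \in a Gamma_(perp i)] implies [f a \in a Gamma_(link i)]
    for f in H.

    The kernel of the projection Gamma -> prod_i G_i has trivial holonomy, and
    finite index in Gamma; this gives one implication.

    Conversely, if H has trivial holonomy, choosing coordinates on one residue of
    type perp i in each H-orbit and transporting them by H gives, for all i, an
    H-invariant labelling of the chambers by G_i, bijective on the panels of
    type i and constant on the residues of type link i. By the universal
    property of Gamma, any two such families of labellings are related by an
    automorphism g; taking for the second one the coordinates of Gamma, the
    group g H g^-1 consists of left multiplications, and it has finite index in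
    Gamma because H is cocompact. *)

Local Notation qrepr := generic_quotient.repr.

(** * Finite index *)

Section SubgroupLemmas.
Variable G : groupType.
Implicit Types (A H K : set G).

Lemma generated_by_ind A (P : G -> Prop) :
  is_subgroup P -> (forall x, A x -> P x) -> forall x, generated_by A x -> P x.
Proof. by move=> Psub AP x; apply. Qed.

Lemma left_coset_eq H x y :
  is_subgroup H -> left_coset x H = left_coset y H -> H (x^-1 * y).
Proof.
move=> [H1 HM HV] xy.
have : left_coset x H y by rewrite xy; exists 1; rewrite ?mulg1.
by move=> [k Hk <-]; rewrite mulKg.
Qed.

Lemma left_coset_eqP H x y :
  is_subgroup H -> H (x^-1 * y) -> left_coset x H = left_coset y H.
Proof.
move=> [H1 HM HV] xy; apply/seteqP; split=> _ [k Hk <-].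
  exists ((x^-1 * y)^-1 * k); first by apply: HM => //; exact: HV.
  by rewrite invgM invgK -!mulgA mulVKg.
by exists (x^-1 * y * k); [exact: HM|rewrite -mulgA mulVKg].
Qed.

(** A map with finitely many values that separates the left cosets of [K] bounds their number; [tau]
    need not be constant on a coset. The finite index results below come down to choosing such a
    map. *)
Lemma finite_index_fiber (T : Type) H K (tau : G -> T) :
  is_subgroup K -> K `<=` H -> finite_set (tau @` H) ->
  (forall x y, H x -> H y -> tau x = tau y -> K (x^-1 * y)) ->
  finite_index K H.
Proof.
move=> Ksub KH tauH tauK; split=> //.
(* [sigma t] is the union of the cosets of [K] by the elements of [H] over [t]; the hypothesis on
   [tau] makes it a single coset when [t] is a value. *)
pose sigma t := [set y | exists x, [/\ H x, tau x = t & K (x^-1 * y)]].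
apply: (@sub_finite_set _ _ (sigma @` (tau @` H))); last exact: finite_image.
move=> _ [x Hx <-]; exists (tau x); first by exists x.
have [K1 KM KV] := Ksub.
apply/seteqP; split=> y.
  move=> [z [Hz zx Kzy]].
  rewrite -(@left_coset_eqP _ z x Ksub); last exact: tauK.
  by exists (z^-1 * y) => //; rewrite mulVKg.
by move=> [k Kk <-]; exists x; split=> //; rewrite mulKg.
Qed.

Lemma finite_index_mono H K L : is_subgroup K -> is_subgroup L ->
  K `<=` L -> L `<=` H -> finite_index K H -> finite_index L H.
Proof.
move=> Ksub Lsub KL LH [_ fin].
apply: (finite_index_fiber Lsub LH (tau := fun x => left_coset x K)) => //.
by move=> x y _ _ /(left_coset_eq Ksub) /KL.
Qed.

Lemma conj_by_subgroup g H : is_subgroup H -> is_subgroup (conj_by g H).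
Proof.
move=> [H1 HM HV]; split.
- by exists 1; rewrite ?mulg1 ?mulgV.
- move=> _ _ [x Hx <-] [y Hy <-]; exists (x * y); first exact: HM.
  by rewrite !mulgA mulgVK.
- by move=> _ [x Hx <-]; exists x^-1; [exact: HV|rewrite !invgM invgK mulgA].
Qed.

Lemma subgroupI H K : is_subgroup H -> is_subgroup K -> is_subgroup (H `&` K).
Proof.
move=> [H1 HM HV] [K1 KM KV]; split=> //.
- by move=> x y [? ?] [? ?]; split; [exact: HM|exact: KM].
- by move=> x [? ?]; split; [exact: HV|exact: KV].
Qed.

End SubgroupLemmas.

(** * Graph products *)

Section GraphProductTheory.
Variables (I : finType) (e : rel I) (G : I -> finGroupType).

Local Notation F := (free_product G).
Local Notation Gamma := (graph_product e G).
Local Notation gin := (@gp_in I e G _).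
Local Notation Sub := (@special_subgroup I e G).

Definition gp_word (w : word G) : Gamma :=
  \pi_(normal_quotient (@graph_commutators I e G)) (\pi_F w).

Lemma gp_word_surj (x : Gamma) : exists w, x = gp_word w.
Proof. by elim/quotW: x; elim/quotW=> w; exists w. Qed.

Lemma gp_word_cat u v : gp_word (u ++ v) = gp_word u * gp_word v.
Proof.
apply/esym; apply: etrans (nq_mulE _ _ _) _.
by congr (\pi_ _ _); exact: fp_mulE.
Qed.

Lemma gp_word1 : gp_word [::] = 1.
Proof. by []. Qed.

Lemma gp_word_rel (u v : F) : normal_closure (@graph_commutators I e G) (u^-1 * v) ->
  \pi_(normal_quotient (@graph_commutators I e G)) u =
  \pi_(normal_quotient (@graph_commutators I e G)) v.
Proof. by move=> uv; apply/eqP/nq_eqP. Qed.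

Lemma gp_inM i (g h : G i) : gin (g * h) = gin g * gin h.
Proof.
rewrite -[RHS](gp_word_cat [:: letter g] [:: letter h]) /gp_in /gp_word /fp_in.
congr (\pi_ _ _); apply/esym/eqP/fp_eqP; exact: free_eq_mul.
Qed.

Lemma gp_in1 i : gin (1 : G i) = 1.
Proof. by apply: (@mulgI _ (gin (1 : G i))); rewrite -gp_inM !mulg1. Qed.

Lemma gp_inV i (g : G i) : gin g^-1 = (gin g)^-1.
Proof. by apply: (@mulgI _ (gin g)); rewrite -gp_inM !mulgV gp_in1. Qed.

Lemma gp_in_commute i j (g : G i) (h : G j) : i != j -> e i j ->
  gin g * gin h = gin h * gin g.
Proof.
move=> ij eij.
rewrite -[LHS](gp_word_cat [:: letter g] [:: letter h]).
rewrite -[RHS](gp_word_cat [:: letter h] [:: letter g]).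
have wordM (u v : word G) : \pi_F (u ++ v) = \pi_F u * \pi_F v :> F.
  by apply/esym; exact: fp_mulE.
apply/esym/gp_word_rel; rewrite !wordM -!/(fp_in _).
have [_ NJ] := normal_closure_normal (@graph_commutators I e G).
have comm : normal_closure (@graph_commutators I e G)
    (fp_in g * fp_in h * (fp_in g)^-1 * (fp_in h)^-1).
  by move=> N [_ AN]; apply: AN; exists i, j, g, h.
have := NJ (fp_in h * fp_in g)^-1 _ comm.
by rewrite invgK !mulgA mulgVK mulgVK.
Qed.

Lemma gp_word_rcons w i (g : G i) : gp_word (rcons w (letter g)) = gp_word w * gin g.
Proof. by rewrite -cats1 gp_word_cat. Qed.

Lemma gp_ind (P : Gamma -> Prop) :
  P 1 -> (forall x i (g : G i), P x -> P (x * gin g)) -> forall x, P x.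
Proof.
move=> P1 PM x; have [w ->] := gp_word_surj x.
elim/last_ind: w => [|w [i g] IH]; first by rewrite gp_word1.
by rewrite (gp_word_rcons w g); exact: PM.
Qed.

(** Inverses of generators require no separate case, because the inverse of a generator from [G i]
    is again one. *)
Lemma special_ind (J : {set I}) (P : Gamma -> Prop) : P 1 ->
  (forall x i (g : G i), i \in J -> P x -> P (x * gin g)) ->
  forall x, Sub J x -> P x.
Proof.
move=> P1 PM x Jx.
(* Stability of [P] under right multiplication by [x] and by [x^-1] defines a subgroup of elements
   [x], whereas [P] itself need not be one. *)
suff /(_ 1 P1)[] : forall y, P y -> P (y * x) /\ P (y * x^-1) by rewrite mul1g.
apply: (generated_by_ind (P := fun x => forall y, P y -> P (y * x) /\ P (y * x^-1))
  _ _ Jx) => [|_ [j /= jJ] [g _ <-] y Py]; last first.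
  by rewrite -gp_inV; split; exact: PM.
split=> [y Py|u v Pu Pv y Py|u Pu y /Pu[]]; last by rewrite invgK.
- by rewrite invg1 mulg1.
- rewrite invgM !mulgA; split; first by have /Pu[/Pv[]] := Py.
  by have /Pv[_ /Pu[]] := Py.
Qed.

Lemma special_subgroup_subgroup J : is_subgroup (Sub J).
Proof. exact: generated_by_subgroup. Qed.

Lemma special_in (J : {set I}) i (g : G i) : i \in J -> Sub J (gin g).
Proof. by move=> iJ H [_ AH]; apply: AH; exists i => //; exists g. Qed.

Lemma special_sub (J K : {set I}) : J \subset K -> Sub J `<=` Sub K.
Proof.
move=> /fintype.subsetP JK x.
have [K1 KM _] := special_subgroup_subgroup K.
apply: (special_ind (P := Sub K)) => // y i g iJ Ky.
by apply: KM => //; apply: special_in; exact: JK.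
Qed.

Lemma special0 x : Sub finset.set0 x -> x = 1.
Proof. by move: x; apply: special_ind => // y i g; rewrite inE. Qed.

Lemma special1 i x : Sub [set i]%SET x -> exists g : G i, x = gin g.
Proof.
move: x; apply: special_ind => [|x j g /set1P ji [h ->]].
  by exists 1; rewrite gp_in1.
by subst j; exists (h * g); rewrite gp_inM.
Qed.

(** * Right actions of the graph product, from its universal property *)

Section Action.
Variables (X : Type) (act : forall i, X -> G i -> X).
Hypothesis act1 : forall i p, act p (1 : G i) = p.
Hypothesis actM : forall i p (g h : G i), act p (g * h) = act (act p g) h.
Hypothesis actC : forall i j p (g : G i) (h : G j), i != j -> e i j ->
  act (act p g) h = act (act p h) g.

Definition word_act (p : X) (w : word G) : X :=
  foldl (fun p (l : {i : I & G i}) => act p (tagged l)) p w.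

Lemma word_act_cat p u v : word_act p (u ++ v) = word_act (word_act p u) v.
Proof. exact: foldl_cat. Qed.

Lemma word_act_free u v : free_eq u v -> forall p, word_act p u = word_act p v.
Proof.
elim=> {u v} [//|u v _ uv p|u v w _ uv _ vw p|u u' v v' _ uu' _ vv' p|i p|i g h p] /=.
- by rewrite uv.
- by rewrite uv.
- by rewrite !word_act_cat uu' vv'.
- exact: act1.
- by rewrite actM.
Qed.

(** The elements of the free product that act trivially form a normal subgroup, which contains the
    commutators by [actC]. *)
Lemma word_act_normal x : normal_closure (@graph_commutators I e G) x ->
  forall p, word_act p (qrepr x) = p.
Proof.
have reprP (w : word G) p : word_act p (qrepr (\pi_F w)) = word_act p w.
  by apply: word_act_free; apply: free_eq_sym; exact: fp_reprP.
have reprM (u v : F) p : word_act p (qrepr (u * v)) =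
    word_act (word_act p (qrepr u)) (qrepr v).
  by rewrite -word_act_cat; exact: reprP.
have repr1 p : word_act p (qrepr (1 : F)) = p.
  exact: (reprP [::] p).
move=> Nx.
pose N := [set x : F | forall p, word_act p (qrepr x) = p].
apply: (Nx N); split; first split=> //; first split=> //.
- by move=> u v Nu Nv p; rewrite reprM Nu Nv.
- by move=> u Nu p; rewrite -{1}[p]Nu -reprM mulgV repr1.
- by move=> g u Nu p; rewrite !reprM Nu -reprM mulgV repr1.
move=> _ [i [j [g [h [ij eij ->]]]]] p.
rewrite !reprM.
have inP k (a : G k) q : word_act q (qrepr (fp_in a)) = act q a.
  exact: reprP.
have inVP k (a : G k) q : word_act q (qrepr (fp_in a)^-1) = act q a^-1.
  by rewrite -[q in LHS](act1 k) -(mulVg a) actM -inP -reprM mulgV repr1.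
by rewrite !inP !inVP actC // -actM mulgV act1 -actM mulgV act1.
Qed.

(** An element of Gamma is a class of classes of words, hence the two nested representatives;
    [gp_act_word] shows that their choice does not matter. *)
Definition gp_act (p : X) (x : Gamma) : X :=
  word_act p (qrepr (qrepr x)).

Lemma gp_act_word p w : gp_act p (gp_word w) = word_act p w.
Proof.
rewrite /gp_act.
set x := qrepr (gp_word w).
have /nq_eqP/word_act_normal N :
    gp_word w == \pi_(normal_quotient (@graph_commutators I e G)) x.
  by rewrite /x reprK.
have xE : x = \pi_F w * ((\pi_F w)^-1 * x) by rewrite mulVKg.
have reprE (u v : F) : free_eq (qrepr (u * v))
    (qrepr u ++ qrepr v).
  by apply: free_eq_sym; exact: fp_reprP.
rewrite xE (word_act_free (reprE _ _)) word_act_cat N.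
by apply: word_act_free; apply: free_eq_sym; exact: fp_reprP.
Qed.

Lemma gp_act1 p : gp_act p 1 = p.
Proof. by rewrite -gp_word1 gp_act_word. Qed.

Lemma gp_act_in p x i (g : G i) : gp_act p (x * gin g) = act (gp_act p x) g.
Proof.
have [w ->] := gp_word_surj x.
by rewrite -(gp_word_rcons w g) !gp_act_word -cats1 word_act_cat.
Qed.

End Action.

(** * Coordinates of the graph product in the groups [G i] *)

Definition coord_act i (p : {dffun forall j, G j}) (g : G i) : {dffun forall j, G j} :=
  finfun (eqtype.dfwith p (p i * g)).

(** Each [G i] acts on the product of all [G j] by right multiplication in the factor [i]; the orbit
    map of the identity is the projection of Gamma to this product. *)
Definition gp_coord (i : I) (x : Gamma) : G i :=
  gp_act coord_act (finfun (fun j => 1 : G j)) x i.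

Lemma coord_act_same i (p : {dffun forall j, G j}) (g : G i) : coord_act p g i = p i * g.
Proof. by rewrite ffunE eqtype.dfwith_in. Qed.

Lemma coord_act_other i j (p : {dffun forall j, G j}) (g : G i) :
  i != j -> coord_act p g j = p j.
Proof. by move=> ij; rewrite ffunE eqtype.dfwith_out. Qed.

Lemma coord_act1 i (p : {dffun forall j, G j}) : coord_act p (1 : G i) = p.
Proof.
apply/ffunP => j; have [<-|ij] := eqVneq i j; last by rewrite coord_act_other.
by rewrite coord_act_same mulg1.
Qed.

Lemma coord_actM i (p : {dffun forall j, G j}) (g h : G i) :
  coord_act p (g * h) = coord_act (coord_act p g) h.
Proof.
apply/ffunP => j; have [<-|ij] := eqVneq i j; last by rewrite !coord_act_other.
by rewrite !coord_act_same mulgA.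
Qed.

Lemma coord_actC i j (p : {dffun forall j, G j}) (g : G i) (h : G j) :
  i != j -> e i j -> coord_act (coord_act p g) h = coord_act (coord_act p h) g.
Proof.
move=> ij _; have ji : j != i by rewrite eq_sym.
apply/ffunP => k; have [<-|ik] := eqVneq i k.
  by rewrite coord_act_other // !coord_act_same coord_act_other.
rewrite [RHS]coord_act_other //; have [<-|jk] := eqVneq j k.
  by rewrite !coord_act_same coord_act_other.
by rewrite !coord_act_other.
Qed.

Lemma gp_coord1 i : gp_coord i 1 = 1.
Proof.
by rewrite /gp_coord (gp_act1 coord_act1 coord_actM coord_actC) ffunE.
Qed.

Lemma gp_coord_mul_in i x (g : G i) : gp_coord i (x * gin g) = gp_coord i x * g.
Proof.
by rewrite /gp_coord (gp_act_in coord_act1 coord_actM coord_actC) coord_act_same.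
Qed.

Lemma gp_coord_mul_other i j x (g : G j) : j != i -> gp_coord i (x * gin g) = gp_coord i x.
Proof.
move=> ji.
by rewrite /gp_coord (gp_act_in coord_act1 coord_actM coord_actC) coord_act_other.
Qed.

Lemma gp_coordM i x y : gp_coord i (x * y) = gp_coord i x * gp_coord i y.
Proof.
move: y; apply: gp_ind => [|y j g IH]; first by rewrite gp_coord1 !mulg1.
rewrite mulgA; have [ji|ji] := eqVneq j i; last by rewrite !gp_coord_mul_other.
by subst j; rewrite !gp_coord_mul_in IH mulgA.
Qed.

Lemma gp_coordV i x : gp_coord i x^-1 = (gp_coord i x)^-1.
Proof. by apply: (@mulgI _ (gp_coord i x)); rewrite -gp_coordM !mulgV gp_coord1. Qed.

Lemma gp_coord_in i (g : G i) : gp_coord i (gin g) = g.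
Proof. by rewrite -[gin g]mul1g gp_coord_mul_in gp_coord1 mul1g. Qed.

Lemma gp_in_inj i : injective (@gp_in I e G i).
Proof. exact: can_inj (@gp_coord_in i). Qed.

Lemma gp_coord_special (i : I) (J : {set I}) x : i \notin J -> Sub J x -> gp_coord i x = 1.
Proof.
move=> iJ; move: x; apply: special_ind => [|x j g jJ IH]; first exact: gp_coord1.
by rewrite gp_coord_mul_other //; apply: contraNneq iJ => <-.
Qed.

Definition link (i : I) : {set I} := [set j | (j != i) && e i j]%SET.

Lemma link_perp i : link i \subset perp e i.
Proof. by apply/fintype.subsetP => j; rewrite !inE => /andP[_ ->]; rewrite orbT. Qed.

Lemma link_irr i : i \notin link i.
Proof. by rewrite inE eqxx. Qed.

Lemma perp_refl i : i \in perp e i.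
Proof. by rewrite inE eqxx. Qed.

(** The generators from [link i] commute with [G i], so factors from [G i] can be collected on the
    left. *)
Lemma special_perp i x : Sub (perp e i) x ->
  exists g k, Sub (link i) k /\ x = gin (g : G i) * k.
Proof.
have [L1 LM _] := special_subgroup_subgroup (link i).
have LC k (g : G i) : Sub (link i) k -> k * gin g = gin g * k.
  move: k; apply: special_ind => [|k j h]; first by rewrite mulg1 mul1g.
  rewrite inE => /andP[ji ij] IH.
  by rewrite -mulgA -(gp_in_commute _ _ _ ij) 1?eq_sym // mulgA IH mulgA.
move: x; apply: special_ind => [|_ j h + [g [k [Lk ->]]]].
  by exists 1, 1; rewrite gp_in1 mulg1.
rewrite inE; have [ji _|ji /= ij] := eqVneq j i.
  by subst j; exists (g * h), k; rewrite -mulgA LC // gp_inM mulgA.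
exists g, (k * gin h); rewrite mulgA; split=> //.
by apply: LM => //; apply: special_in; rewrite inE ji.
Qed.

(** In the decomposition of [special_perp], the factor from [G i] is exactly the coordinate of index
    [i]. *)
Lemma special_link i x : Sub (perp e i) x -> gp_coord i x = 1 -> Sub (link i) x.
Proof.
move=> /special_perp[g [k [Lk ->]]].
rewrite gp_coordM gp_coord_in (gp_coord_special (link_irr i) Lk) mulg1 => ->.
by rewrite gp_in1 mul1g.
Qed.

End GraphProductTheory.

(** * Automorphisms and chambers *)

Section ModelTheory.
Variables (R : realType) (I : finType) (e : rel I).
Implicit Types (x y : model R e) (J s : {set I}).

Lemma modelP x : exists2 s, spherical e s & unit_cube s (set_val x).
Proof. by case: x => z zP /=; have [s] := set_mem zP; exists s. Qed.

Lemma model_ext x y : coordinate x =1 coordinate y -> x = y.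
Proof. by move=> xy; apply: val_inj; apply/funext. Qed.

Definition mk_model (z : I -> R) (zP : @model_space R I e z) : model R e :=
  SigSub (mem_set zP).

Lemma mk_modelE z zP i : coordinate (@mk_model z zP) i = z i.
Proof. by []. Qed.

Lemma spherical_sub J s : J \subset s -> spherical e s -> spherical e J.
Proof.
move=> /fintype.subsetP Js /forall_inP ss; apply/forall_inP => i /Js iJ.
by apply/forall_inP => j /Js jJ; move/forall_inP: (ss i iJ); apply.
Qed.

Lemma spherical0 : spherical e finset.set0.
Proof. by apply/forall_inP => i; rewrite inE. Qed.

Lemma spherical1 i : spherical e [set i]%SET.
Proof.
by apply/forall_inP => j /set1P ->; apply/forall_inP => k /set1P ->; rewrite eqxx.
Qed.

Lemma vertex_subproof J : spherical e J ->
  @model_space R I e (fun i => (i \in J)%:R%R).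
Proof.
move=> sJ; exists J => // i; split; first by case: (i \in J); rewrite ?lexx ler01.
by move=> /negbTE ->.
Qed.

Definition model_vertex J (sJ : spherical e J) : model R e :=
  mk_model (vertex_subproof sJ).

Lemma model_vertexP J (sJ : spherical e J) : is_model_vertex J (model_vertex sJ).
Proof. by move=> i; rewrite mk_modelE. Qed.

Lemma model_vertex_uniq J x y : is_model_vertex J x -> is_model_vertex J y -> x = y.
Proof. by move=> xJ yJ; apply: model_ext => i; rewrite xJ yJ. Qed.

Lemma tbar_vertex J x : is_model_vertex J x -> tbar x = J.
Proof.
move=> xJ; apply/setP => i; rewrite inE xJ.
by case: (i \in J); rewrite ?eqxx // eq_sym oner_eq0.
Qed.

Definition origin : model R e := model_vertex spherical0.

Lemma origin_vertex : is_model_vertex finset.set0 origin.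
Proof. exact: model_vertexP. Qed.

Lemma originE i : coordinate origin i = 0%R.
Proof. by rewrite origin_vertex inE. Qed.

(** A point of a cube is determined by its distances to the vertices of the cube. This rigidity
    turns isometries that fix the vertices into identities. *)
Lemma vertex_dist_inj s (x y : model R e) : spherical e s ->
    unit_cube s (set_val x) ->
    (forall J (z : model R e), J \subset s -> is_model_vertex J z ->
       euclidean_dist (set_val y) (set_val z) = euclidean_dist (set_val x) (set_val z)) ->
  y = x.
Proof.
move=> ss xs xy.
have sq J (z : model R e) : J \subset s -> is_model_vertex J z ->
    (\sum_i (coordinate y i - (i \in J)%:R) ^+ 2 =
     \sum_i (coordinate x i - (i \in J)%:R) ^+ 2)%R.
  move=> Js zJ; have := xy J z Js zJ; rewrite /euclidean_dist => /eqP.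
  rewrite eqr_sqrt; try by apply: sumr_ge0 => i _; exact: sqr_ge0.
  by move=> /eqP; under eq_bigr do rewrite -!/(coordinate _ _) zJ;
    under [in RHS]eq_bigr do rewrite -!/(coordinate _ _) zJ.
have sq0 := sq finset.set0 origin (finset.sub0set _) origin_vertex.
(* Since t^2 - (t - 1)^2 = 2t - 1, the distances to the origin and to the vertex of type {i}
   determine the coordinate of index [i]. *)
have in_s i : i \in s -> coordinate y i = coordinate x i.
  move=> si; have is_ : [set i]%SET \subset s by rewrite finset.sub1set.
  have := sq _ _ is_ (model_vertexP (spherical1 i)).
  move: sq0; rewrite (bigD1 i) //= [in RHS](bigD1 i) //= => sq0.
  rewrite (bigD1 i) //= [in RHS](bigD1 i) //= !inE eqxx.
  have E (z : model R e) : (\sum_(j | j != i) (coordinate z j - (j \in [set i]%SET)%:R) ^+ 2 =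
      \sum_(j | j != i) (coordinate z j - (j \in finset.set0)%:R) ^+ 2)%R.
    by apply: eq_bigr => j /negbTE ji; rewrite !inE ji.
  rewrite !E; move: sq0; rewrite !inE /= => sq0 sq1.
  by lra.
(* The distances to the origin agree and so do the coordinates in [s]; what remains is a vanishing
   sum of squares, as [x] is zero outside [s]. *)
have sqs : (\sum_(i | i \notin s) (coordinate y i) ^+ 2 = 0)%R.
  move: sq0; rewrite (bigID (mem s)) /= [in RHS](bigID (mem s)) /=.
  have -> : (\sum_(i in s) (coordinate y i - (i \in finset.set0)%:R) ^+ 2 =
      \sum_(i in s) (coordinate x i - (i \in finset.set0)%:R) ^+ 2)%R.
    by apply: eq_bigr => i si; rewrite in_s.
  move=> /addrI; rewrite [RHS]big1 => [|i si]; last first.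
    by rewrite /coordinate (xs i).2 // inE subr0 expr0n.
  by move=> sqs; rewrite -[RHS]sqs; apply: eq_big => // i _; rewrite inE subr0.
apply: model_ext => i; have [/in_s//|si] := boolP (i \in s).
rewrite [RHS](xs i).2 //; apply/eqP; rewrite -sqrf_eq0; apply/eqP.
move/eqP: sqs; rewrite psumr_eq0 => [/allP|j _]; last exact: sqr_ge0.
by move=> /(_ i); rewrite mem_index_enum si => /(_ isT)/eqP.
Qed.

End ModelTheory.

(** * Automorphisms as permutations of the chambers *)

Section Automorphisms.
Variables (R : realType) (I : finType) (e : rel I) (G : I -> finGroupType).

Local Notation Gamma := (graph_product e G).
Local Notation gin := (@gp_in I e G _).
Local Notation Sub := (@special_subgroup I e G).
Local Notation pt := (@pt R I e G).
Local Notation o := (@origin R I e).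
Local Notation Aut := (@Aut0 R I e G).
Implicit Types (f g h : Aut) (x y : model R e) (J : {set I}).

(** The group of the empty type is trivial, so a vertex of empty type lies in one chamber only and
    can stand for it. *)
Lemma pt_inj_origin (a b : Gamma) x : pt a x = pt b o -> a = b.
Proof.
move=> /ptP[-> ]; rewrite (tbar_vertex (@origin_vertex R I e)) => /special0 ab.
by rewrite -[a]mulg1 -ab mulVKg.
Qed.

Lemma pt_eq (a b : Gamma) x : Sub (tbar x) (a^-1 * b) -> pt a x = pt b x.
Proof. by move=> ab; apply/ptP. Qed.

Lemma aut_origin f a : exists b, f (pt a o) = pt b o.
Proof.
have [|b [x [x0 ->]]] := aut_fun_type f (J := finset.set0) (p := pt a o).
  by exists a, o; split=> //; exact: origin_vertex.
by exists b; rewrite (model_vertex_uniq x0 (@origin_vertex R I e)).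
Qed.

Definition chamber_map f (a : Gamma) : Gamma := projT1 (cid (aut_origin f a)).

Lemma chamber_map_origin f a : f (pt a o) = pt (chamber_map f a) o.
Proof. by rewrite /chamber_map; case: cid. Qed.

Lemma face_cube s x : unit_cube s (set_val x) -> face finset.set0 s x.
Proof. by move=> xs i; have [xi xi0] := xs i; split=> //; rewrite inE. Qed.

(** On a cube containing the central vertex, [f] is an isometry that preserves types, hence fixes
    the vertices in model coordinates, hence all points by [vertex_dist_inj]. *)
Lemma chamber_mapE f a x : f (pt a x) = pt (chamber_map f a) x.
Proof.
have [s ss xs] := modelP x.
have cubeP : model_cube (@face R I e finset.set0 s).
  by exists finset.set0, s; split=> //; exact: finset.sub0set.
have [b [P' [phi [P'_cube phi_bij phi_iso phiE]]]] := aut_fun_comb f a cubeP.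
have vertP J (z : model R e) : J \subset s -> is_model_vertex J z -> face finset.set0 s z.
  move=> /fintype.subsetP Js zJ; suff zs : unit_cube s (set_val z) by exact: face_cube.
  move=> i; rewrite -/(coordinate z i) zJ; split.
    by case: (i \in J); rewrite ?lexx ler01.
  by move=> si; rewrite (negbTE (contra (Js i) si)).
have phi_vertex J (z : model R e) : J \subset s -> is_model_vertex J z -> phi z = z.
  move=> Js zJ; have fz := vertP J z Js zJ.
  have [|c [z' [z'J]]] := aut_fun_type f (J := J) (p := pt a z); first by exists a, z.
  rewrite phiE ?inE // => /ptP[-> _]; exact: model_vertex_uniq z'J zJ.
have phi_id (z : model R e) : unit_cube s (set_val z) -> phi z = z.
  move=> zs; apply: (vertex_dist_inj ss zs) => J v Js vJ.
  rewrite -{1}(phi_vertex J v Js vJ) phi_iso ?inE //; [|exact: (vertP J)].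
  exact: face_cube.
have o_cube : unit_cube s (set_val o).
  move=> i; rewrite -/(coordinate o i) originE; split=> //.
  by rewrite lexx ler01.
have -> : f (pt a x) = pt b x.
  by rewrite phiE ?phi_id // inE; exact: face_cube.
(* The cube contains the origin, whose image identifies the chamber [b]. *)
congr (pt _ x); apply: (@pt_inj_origin _ _ o); rewrite -chamber_map_origin.
by rewrite phiE ?phi_id // inE; exact: face_cube.
Qed.

Lemma aut_ext f g : chamber_map f =1 chamber_map g -> f = g.
Proof.
by move=> fg; apply: aut0_ext => p; have [a [x ->]] := pt_surj p; rewrite !chamber_mapE fg.
Qed.

Lemma chamber_mapM f g a : chamber_map (f * g) a = chamber_map f (chamber_map g a).
Proof.
apply: (@pt_inj_origin _ _ o); rewrite -chamber_mapE.
by rewrite -[LHS]/(f (g (pt a o))) !chamber_mapE.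
Qed.

Lemma chamber_map1 a : chamber_map 1 a = a.
Proof. by apply: (@pt_inj_origin _ _ o); rewrite -chamber_mapE. Qed.

Lemma chamber_mapK f : cancel (chamber_map f) (chamber_map f^-1).
Proof. by move=> a; rewrite -chamber_mapM mulVg chamber_map1. Qed.

Lemma chamber_mapVK f : cancel (chamber_map f^-1) (chamber_map f).
Proof. by move=> a; rewrite -chamber_mapM mulgV chamber_map1. Qed.

Lemma chamber_map_left c a : chamber_map (left_aut R c) a = c * a.
Proof.
apply: (@pt_inj_origin _ _ o); rewrite -chamber_mapE.
exact: left_actE.
Qed.

(** The chambers of [a] and [a * gin g] share a vertex of type {i}, and its image lies in both image
    chambers. *)
Lemma chamber_map_adj f a i (g : G i) :
  exists h : G i, chamber_map f (a * gin g) = chamber_map f a * gin h.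
Proof.
pose v := model_vertex R (spherical1 e i); have vi := model_vertexP R (spherical1 e i).
have : pt (chamber_map f a) v = pt (chamber_map f (a * gin g)) v.
  rewrite -!chamber_mapE; congr (f _); apply: pt_eq; rewrite mulKg.
  by apply: special_in; rewrite (tbar_vertex vi) inE.
move=> /ptP[_]; rewrite (tbar_vertex vi) => /special1[h hE].
by exists h; rewrite -hE mulVKg.
Qed.

Lemma chamber_map_special f a J (x : Gamma) : Sub J x ->
  Sub J ((chamber_map f a)^-1 * chamber_map f (a * x)).
Proof.
have [J1 JM _] := @special_subgroup_subgroup I e G J.
move: x; apply: special_ind => [|x i g iJ]; first by rewrite mulg1 mulVg.
rewrite mulgA; have [h ->] := chamber_map_adj f (a * x) g; rewrite mulgA => IH.
by apply: JM => //; exact: special_in.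
Qed.

Lemma chamber_map_special_eq f a b J : Sub J (a^-1 * b) ->
  Sub J ((chamber_map f a)^-1 * chamber_map f b).
Proof. by move=> /(chamber_map_special f a); rewrite mulVKg. Qed.

Definition panel_map (K : Gamma -> Gamma) : Prop :=
  forall a i (g : G i), exists h : G i, K (a * gin g) = K a * gin h.

Section FromChambers.
Variables F E : Gamma -> Gamma.
Hypotheses (FK : cancel F E) (EK : cancel E F).
Hypothesis F_adj : panel_map F.
Hypothesis E_adj : panel_map E.

(** The map moves the chamber and keeps the model coordinate. For a panel map the chosen
    representative is harmless, since cosets of special subgroups go into cosets of the same
    type. *)
Definition extend (K : Gamma -> Gamma) (p : building R e G) : building R e G :=
  let q := qrepr (p : {eq_quot building_equiv R e G}) in
  pt (K q.1) q.2.

Lemma extendE (K : Gamma -> Gamma) :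
  panel_map K ->
  forall a x, extend K (pt a x) = pt (K a) x.
Proof.
move=> K_adj a x; rewrite /extend; set q := qrepr _.
have : pt q.1 q.2 = pt a x by rewrite /Defs.pt -surjective_pairing reprK.
move=> /ptP[-> Jq]; apply: pt_eq; rewrite -[a](mulVKg q.1).
have [J1 JM _] := @special_subgroup_subgroup I e G (tbar x).
move: Jq; move: (_ * a); apply: special_ind => [|y i g iJ]; first by rewrite mulg1 mulVg.
rewrite mulgA; have [h ->] := K_adj (q.1 * y) i g; rewrite mulgA => IH.
by apply: JM => //; exact: special_in.
Qed.

Lemma extendK (K L : Gamma -> Gamma) :
  panel_map K ->
  panel_map L ->
  cancel K L -> cancel (extend K) (extend L).
Proof.
by move=> Kad Lad KK p; have [a [x ->]] := pt_surj p; rewrite !extendE // KK.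
Qed.

Lemma extend_comb (K : Gamma -> Gamma) :
  panel_map K ->
  combinatorial (extend K).
Proof.
move=> Kad a P P_cube; exists (K a), P, id; split=> //.
  by split=> // x Px; exists x.
by move=> x _; rewrite extendE.
Qed.

Lemma extend_type (K : Gamma -> Gamma) :
  panel_map K ->
  type_preserving (extend K).
Proof.
by move=> Kad J _ [a [x [xJ ->]]]; exists (K a), x; rewrite extendE.
Qed.

Definition chamber_aut : Aut :=
  MkAut0 (extendK F_adj E_adj FK) (extendK E_adj F_adj EK) (extend_comb F_adj)
    (extend_comb E_adj) (extend_type F_adj) (extend_type E_adj).

Lemma chamber_map_aut a : chamber_map chamber_aut a = F a.
Proof.
by apply: (@pt_inj_origin _ _ o); rewrite -chamber_mapE; exact: extendE.
Qed.

End FromChambers.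

End Automorphisms.

(** * Continuity and connectedness in the model and the building *)

Section Topology.
Variables (R : realType) (I : finType) (e : rel I) (G : I -> finGroupType).
Local Notation pt := (@pt R I e G).
Local Notation o := (@origin R I e).
Implicit Types (x y : model R e) (J s : {set I}).

Lemma model_continuous (T : topologicalType) (f : T -> model R e) :
  (forall i, continuous (fun t => coordinate (f t) i)) -> continuous f.
Proof.
move=> fc; apply: (@continuous_comp_initial _ _ _ set_val) => t.
apply/cvg_sup.
move=> i; move: t.
apply/(@continuousP _ (initial_topology (fun z : I -> R => z i))) => _ [B oB <-].
by move/continuousP: (fc i); apply.
Qed.

Lemma coordinate_continuous i : continuous (fun x => coordinate x i).
Proof.
move=> x; apply: (continuous_comp (f := set_val) (g := fun z : euclidean R I => z i)).
  exact: initial_continuous.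
exact: (@proj_continuous I (fun=> R) i).
Qed.

(** Truncation to [0, 1] lets the segment [shrink x] be parametrized by the whole real line, whose
    connectedness is at hand. *)
Definition clamp (t : R) : R := Num.min (Num.max t 0)%R 1%R.

Lemma clamp_itv t : (0 <= clamp t <= 1)%R.
Proof. by rewrite /clamp le_min ge_min le_max !lexx ler01 !orbT. Qed.

Lemma clamp_continuous : continuous clamp.
Proof.
move=> t; apply: (@continuous_min R R (fun t => Num.max t 0%R : R^o) (cst 1%R) t);
  last exact: cst_continuous.
by apply: (@continuous_max R R (fun t => t : R^o) (cst 0%R) t);
  [exact: cvg_id|exact: cst_continuous].
Qed.

Lemma shrink_subproof x (t : R) :
  @model_space R I e (fun i => clamp t * coordinate x i)%R.
Proof.
have [s ss xs] := modelP x; exists s => // i.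
have [/andP[x0 x1] xi] := xs i; have /andP[t0 t1] := clamp_itv t.
split; first by rewrite mulr_ge0 //= mulr_ile1.
by move=> /xi xi0; rewrite /coordinate xi0 mulr0.
Qed.

Definition shrink x t : model R e := mk_model (shrink_subproof x t).

Lemma shrink_continuous x : continuous (shrink x).
Proof.
apply: model_continuous => i t.
by apply: cvgM; [exact: clamp_continuous|exact: cvg_cst].
Qed.

Lemma shrink0 x : shrink x 0%R = o.
Proof.
apply: model_ext => i; rewrite originE mk_modelE /clamp maxxx.
by rewrite (min_idPl _) ?mul0r // ler01.
Qed.

Lemma shrink1 x : shrink x 1%R = x.
Proof.
apply: model_ext => i; rewrite mk_modelE /clamp (max_idPl _) ?ler01 //.
by rewrite minxx mul1r.
Qed.

(** The set is a union of segments issuing from the origin. *)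
Lemma star_connected (S : set (model R e)) :
  S !=set0 -> (forall x t, S x -> S (shrink x t)) -> connected S.
Proof.
move=> [x0 Sx0] Sshrink.
have -> : S = \bigcup_(x in S) range (shrink x).
  apply/seteqP; split=> [x Sx|_ [x Sx [t _ <-]]]; last exact: Sshrink.
  by exists x => //; exists 1%R => //; exact: shrink1.
apply: bigcup_connected => [|x Sx].
  by exists o => x Sx; exists 0%R => //; exact: shrink0.
have Rc : connected [set: R] by apply: (iffRL (connected_intervalP _)).
apply: (connected_continuous_connected Rc); exact/continuous_subspaceT/shrink_continuous.
Qed.

Lemma pt_continuous a : continuous (pt a).
Proof.
have pc := @pi_continuous (prebuilding R e G) {eq_quot building_equiv R e G}.
have ac : continuous (fun x : model R e => (a : discrete_topology (graph_product e G), x)).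
  move=> x A [[U V] /= [Ua Vx] sUV].
  by apply: filterS Vx => y Vy; apply: sUV; split=> //=; exact: nbhs_singleton Ua.
move=> x; apply: (continuous_comp (f := fun x => (a, x) : prebuilding R e G)).
  exact: ac.
exact: pc.
Qed.

Definition supported J x := forall k, k \notin J -> coordinate x k = 0%R.

Lemma supported_origin J : supported J o.
Proof. by move=> k _; exact: originE. Qed.

Lemma supported_sub J s x : J \subset s -> supported J x -> supported s x.
Proof. by move=> /fintype.subsetP Js xJ k ks; apply: xJ; apply: contra ks; exact: Js. Qed.

Lemma supported_connected J a : connected (pt a @` supported J).
Proof.
apply: connected_continuous_connected; last exact/continuous_subspaceT/pt_continuous.
apply: star_connected; first by exists o; exact: supported_origin.
by move=> x t xJ k /xJ xk; rewrite mk_modelE xk mulr0.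
Qed.

End Topology.

(** * Residues and holonomy *)

Section Residues.
Variables (R : realType) (I : finType) (e : rel I) (G : I -> finGroupType).

Local Notation Gamma := (graph_product e G).
Local Notation gin := (@gp_in I e G _).
Local Notation Sub := (@special_subgroup I e G).
Local Notation pt := (@pt R I e G).
Local Notation o := (@origin R I e).
Local Notation Aut := (@Aut0 R I e G).
Implicit Types (f g : Aut) (x y : model R e) (J : {set I}) (a b h : Gamma).

Lemma cube_type_face a (A B : {set I}) : A \subset B -> spherical e B ->
  cube_type (pt a @` face A B) = B.
Proof.
move=> /fintype.subsetP AB sB; have vB := model_vertexP R sB.
have topB : is_largest_type (pt a @` face A B) B.
  split.
    exists (pt a (model_vertex R sB)); last by exists a, (model_vertex R sB).
    exists (model_vertex R sB) => // i; rewrite vB; split.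
    - by case: (i \in B); rewrite ?lexx ler01.
    - by move=> /AB ->.
    - by move=> /negbTE ->.
  move=> K _ [x xf <-] [b [y [yK /ptP[xy _]]]]; apply/fintype.subsetP => i iK.
  apply: contraT => iB; have [_ _ /(_ iB)] := xf i.
  by rewrite xy yK iK => /eqP; rewrite oner_eq0.
apply: xget_unique => // J [[p Qp pJ] topJ]; apply/eqP; rewrite finset.eqEsubset.
apply/andP; split; first by apply: topB.2 pJ.
by have [[q Qq qB] _] := topB; apply: topJ qB.
Qed.

(** If [s] spans a cube containing [x], the face spanned by [s :&: J] still contains [x], whose
    coordinates outside [J] vanish. *)
Lemma cube_at a x J : supported J x -> exists Q,
  [/\ is_cube Q, Q (pt a x), cube_type Q \subset J, Q `<=` range (pt a) &
      forall q, Q q -> exists2 y, supported J y & q = pt a y].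
Proof.
move=> xJ; have [s ss xs] := modelP x.
have sJ : s :&: J \subset J by exact: finset.subsetIr.
have sphere : spherical e (s :&: J) by apply: spherical_sub ss; exact: finset.subsetIl.
have faceP : model_cube (@face R I e finset.set0 (s :&: J)).
  by exists finset.set0, (s :&: J); split=> //; exact: finset.sub0set.
exists (pt a @` face finset.set0 (s :&: J)); split.
- by exists a, (face finset.set0 (s :&: J)).
- exists x => // i; have [xi xi0] := xs i; split=> //; first by rewrite inE.
  rewrite inE negb_and => /orP[/xi0//|]; exact: xJ.
- by rewrite cube_type_face // finset.sub0set.
- by move=> _ [y _ <-]; exists y.
- move=> _ [y yf <-]; exists y => // k kJ; have [_ _ ->//] := yf k.
  by rewrite inE (negbTE kJ) andbF.
Qed.

(** A common vertex of type {j} means that the two chambers differ by right multiplication by an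
    element of [G j], so galleries spell elements of the special subgroup. *)
Lemma joinedP J a D : joined J (range (pt a)) D <->
  exists2 h, Sub J h & D = range (pt (a * h)).
Proof.
have [J1 JM _] := @special_subgroup_subgroup I e G J.
split=> [|[h Jh ->]].
  move Da : (range (pt a)) => Da' aD; move: a Da.
  elim: aD => {Da' D} [D D' [_ [b D'E] [j jJ adj]] a DE|D a <-|D D1 D2 _ IH1 _ IH2 a Da].
  - exists (a^-1 * b); last by rewrite mulVKg.
    have [p []] := adj; rewrite -DE D'E => -[[x _ xp] [y _ yx] [c [z [zj]]]].
    rewrite -xp in yx * => /ptP[xz _]; rewrite -xz in zj.
    move/ptP: (esym yx) => [_]; rewrite (tbar_vertex zj).
    by apply: special_sub; rewrite finset.sub1set.
  - by exists 1; rewrite ?mulg1.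
  - have [h1 Jh1 D1E] := IH1 a Da; have [h2 Jh2 ->] := IH2 _ (esym D1E).
    by exists (h1 * h2); rewrite ?mulgA //; exact: JM.
move: h Jh; apply: special_ind => [|h i g iJ IH]; first by rewrite mulg1; exact: rt_refl.
apply: (rt_trans _ _ _ _ _ IH); apply: rt_step.
split; [by exists (a * h)|by exists (a * (h * gin g))|].
exists i => //; have vi := model_vertexP R (spherical1 e i).
exists (pt (a * h) (model_vertex R (spherical1 e i))); split;
  last by exists (a * h), (model_vertex R (spherical1 e i)).
split; first by exists (model_vertex R (spherical1 e i)).
exists (model_vertex R (spherical1 e i)) => //; apply/esym; apply: pt_eq.
by rewrite [a * (h * _)]mulgA mulKg (tbar_vertex vi); apply: special_in; rewrite inE.
Qed.

Lemma residueE J a : residue J (range (pt a)) =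
  [set p | exists b x, [/\ Sub J (a^-1 * b), supported J x & p = pt b x]].
Proof.
apply/seteqP; split.
  move=> p [Q [[c [P [[A [B [AB sB ->]]] ->]]] QJ [D' /joinedP[h Jh ->] QD]] Qp].
  have [x _ xp] := QD p Qp; exists (a * h), x; split=> //; first by rewrite mulKg.
  move=> k kJ; move: Qp QJ; rewrite cube_type_face // => -[y yf yp] /fintype.subsetP BJ.
  move: yp; rewrite -xp => /ptP[<- _]; have [_ _ ->//] := yf k.
  by apply: contra kJ; exact: BJ.
move=> _ [b [x [Jb xJ ->]]]; have [Q [Qcube Qx QJ Qb _]] := cube_at b xJ.
exists Q => //; split=> //; exists (range (pt b)) => //.
by apply/joinedP; exists (a^-1 * b); rewrite ?mulVKg.
Qed.

Lemma i_boundaryE i a : i_boundary i (residue (perp e i) (range (pt a))) =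
  [set p | exists b x, [/\ Sub (perp e i) (a^-1 * b), supported (link e i) x & p = pt b x]].
Proof.
apply/seteqP; split=> [p [Q [[c [P [[A [B [AB sB ->]]] ->]]] + iQ] Qp]|].
  rewrite residueE => /(_ _ Qp)[b [x [Jb xJ pE]]]; exists b, x; split=> // k.
  rewrite inE; have [-> _|ki /= ek] := eqVneq k i; last by apply: xJ; rewrite inE negb_or ki.
  move: iQ Qp; rewrite cube_type_face // => iB [y yf].
  by rewrite pE => /ptP[<- _]; have [_ _ ->] := yf i.
move=> _ [b [x [Jb xJ ->]]]; have [Q [Qcube Qx QJ Qb Qsupp]] := cube_at b xJ.
exists Q => //; split=> //.
  rewrite residueE => q /Qsupp[y yJ ->]; exists b, y; split=> //.
  by apply: supported_sub yJ; exact: link_perp.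
by move/fintype.subsetP: QJ => /(_ i) QJ; apply/negP => /QJ; rewrite (negbTE (link_irr e i)).
Qed.

Lemma residue_eq J a b :
  residue J (range (pt a)) = residue J (range (pt b)) <-> Sub J (a^-1 * b).
Proof.
have [J1 JM JV] := @special_subgroup_subgroup I e G J.
rewrite !residueE; split=> [ab|ab].
  (* The central vertex of the chamber [b] lies in no other chamber, so its membership in the
     residue of [a] decides the coset. *)
  have : [set p | exists c x, [/\ Sub J (b^-1 * c), supported J x & p = pt c x]] (pt b o).
    by exists b, o; split=> //; [rewrite mulVg|exact: supported_origin].
  by rewrite -ab => -[c [x [ac _ /esym/pt_inj_origin <-]]].
apply/seteqP; split=> _ [c [x [cJ xJ ->]]]; exists c, x; split=> //.
  by have := JM _ _ (JV _ ab) cJ; rewrite invgM invgK -mulgA mulVKg.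
by have := JM _ _ ab cJ; rewrite -mulgA mulVKg.
Qed.

Lemma residue_image f J a :
  f @` residue J (range (pt a)) = residue J (range (pt (chamber_map f a))).
Proof.
rewrite !residueE; apply/seteqP; split=> [_ [_ [b [x [ab xJ ->]]] <-]|].
  exists (chamber_map f b), x; split=> //; last exact: chamber_mapE.
  exact: chamber_map_special_eq.
move=> _ [b [x [ab xJ ->]]]; exists (pt (chamber_map f^-1 b) x); last first.
  by rewrite chamber_mapE chamber_mapVK.
exists (chamber_map f^-1 b), x; split=> //.
by have := chamber_map_special_eq f^-1 ab; rewrite chamber_mapK.
Qed.

(* The traces of these open sets on an i-boundary separate its components. *)
Definition near_chambers i (A : set Gamma) : set (building R e G) :=
  [set p | exists b x, [/\ A b,
    (forall k, k \notin link e i -> (coordinate x k < 1)%R) & p = pt b x]].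

(** The condition on [x] forces [tbar x] into the link, so all chambers containing the point lie in
    one coset of the link subgroup, and [A] is a union of such cosets. *)
Lemma near_chambersP i (A : set Gamma) a x :
  (forall b h, A b -> Sub (link e i) h -> A (b * h)) ->
  near_chambers i A (pt a x) <->
  A a /\ (forall k, k \notin link e i -> (coordinate x k < 1)%R).
Proof.
move=> Alink; split=> [[b [y [Ab y1 /esym /ptP[yx ba]]]]|[Aa x1]]; last by exists a, x.
rewrite -yx; split=> //; rewrite -[a](mulVKg b); apply: Alink => //.
apply: special_sub ba; apply/fintype.subsetP => k; rewrite inE => /eqP yk.
by apply: contraT => /y1; rewrite yk ltxx.
Qed.

(** The preimage in Gamma times the model is a product [A] times [U], with [U] open and Gamma
    discrete. *)
Lemma near_chambers_open i (A : set Gamma) :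
  (forall b h, A b -> Sub (link e i) h -> A (b * h)) -> open (near_chambers i A).
Proof.
move=> Alink.
pose U := [set x : model R e | forall k, k \notin link e i -> (coordinate x k < 1)%R].
have Uo : open U.
  rewrite openE => x Ux; apply: (@filter_forall _ I
    (fun k y => k \notin link e i -> (coordinate y k < 1)%R) (nbhs x)) => k.
  have [kL|/Ux xk] := boolP (k \in link e i); first exact: nearW.
  have xk1 : nbhs (coordinate x k) [set t | (t < 1)%R].
    by apply: open_nbhs_nbhs; split; [exact: open_lt|exact: xk].
  have xk2 : nbhs x [set y | (coordinate y k < 1)%R] := @coordinate_continuous R I e k x _ xk1.
  by apply: (@filterS _ (nbhs x) _ _ _ _ xk2) => y yk _; exact: yk.
rewrite /open /= /quotient_open.
have -> : \pi_(quotient_topology {eq_quot building_equiv R e G}) @^-1`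
    near_chambers i A = A `*` U.
  apply/seteqP; split=> -[b x]; first by move=> /(near_chambersP b x Alink).
  by move=> bx; apply/(near_chambersP b x Alink).
rewrite openE => -[b x] [/= Ab Ux]; exists (A, U) => //=; split; last exact: open_nbhs_nbhs.
by apply: open_nbhs_nbhs; split=> //; exact: discrete_open.
Qed.

End Residues.

(** * Holonomy read on the chambers *)

Section Holonomy.
Variables (R : realType) (I : finType) (e : rel I) (G : I -> finGroupType).

Local Notation Gamma := (graph_product e G).
Local Notation gin := (@gp_in I e G _).
Local Notation Sub := (@special_subgroup I e G).
Local Notation pt := (@pt R I e G).
Local Notation o := (@origin R I e).
Local Notation Aut := (@Aut0 R I e G).
Implicit Types (f g : Aut) (x y : model R e) (J : {set I}) (a b h : Gamma).

Lemma vertex_supported J i x : i \in J -> is_model_vertex [set i]%SET x -> supported J x.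
Proof.
by move=> iJ xi k kJ; rewrite xi inE (_ : _ == _ = false) //; apply: contraNF kJ => /eqP ->.
Qed.

(** Follow a word for [h] letter by letter: consecutive chambers share a vertex of type {j} with j
    in the link, and this vertex lies on the boundary. *)
Lemma boundary_component i a b h x y :
  Sub (perp e i) (a^-1 * b) -> Sub (link e i) h ->
  supported (link e i) x -> supported (link e i) y ->
  connected_component (i_boundary i (residue (perp e i) (range (pt a))))
    (pt b x) (pt (b * h) y).
Proof.
move=> ab Lh xL yL; rewrite i_boundaryE; set Y := (X in connected_component X).
have [J1 JM _] := @special_subgroup_subgroup I e G (perp e i).
have chamber c u v : Sub (perp e i) (a^-1 * c) ->
    supported (link e i) u -> supported (link e i) v ->
    connected_component Y (pt c u) (pt c v).
  move=> ac uL vL; exists (pt c @` supported (link e i)); last by exists v.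
  split; [by exists u| |exact: supported_connected].
  by move=> _ [w wL <-]; exists c, w.
suff [_] : Sub (perp e i) (a^-1 * (b * h)) /\ forall y, supported (link e i) y ->
    connected_component Y (pt b x) (pt (b * h) y) by apply.
move: h Lh; apply: special_ind => [|h j g jL [abh IH]].
  by rewrite mulg1; split=> // z zL; exact: chamber.
have abhg : Sub (perp e i) (a^-1 * (b * (h * gin g))).
  rewrite !mulgA in abh *; apply: JM => //; apply: special_in.
  by move/fintype.subsetP: (link_perp e i); apply.
split=> // z zL; pose v := model_vertex R (spherical1 e j).
have vj : is_model_vertex [set j]%SET v by exact: model_vertexP.
have vL : supported (link e i) v by exact: vertex_supported vj.
apply: connected_component_trans (IH v vL) _.
have -> : pt (b * h) v = pt (b * (h * gin g)) v.
  apply: pt_eq; rewrite (tbar_vertex vj) [b * (h * _)]mulgA mulKg.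
  by apply: special_in; rewrite inE.
exact: chamber.
Qed.

(** The components of the boundary correspond to the cosets of the link subgroup in [a] times the
    perp subgroup: [boundary_component] connects each coset, and [near_chambers] separates distinct
    ones. *)
Lemma trivial_holonomy_chambers (L : set Aut) : is_subgroup L ->
  trivial_holonomy L <-> (forall f i a, L f ->
    Sub (perp e i) (a^-1 * chamber_map f a) -> Sub (link e i) (a^-1 * chamber_map f a)).
Proof.
move=> [L1 LM LV]; split=> [hol f i a Lf fa|hol i _ [_ [a ->] ->] f [Lf fX] K].
  set X := residue (perp e i) (range (pt a)).
  have Ya : i_boundary i X (pt a o).
    rewrite i_boundaryE; exists a, o; split=> //; last exact: supported_origin.
    by rewrite mulVg; have [] := @special_subgroup_subgroup I e G (perp e i).
  have stab : residue_stabilizer L X f.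
    by split=> //; rewrite residue_image; apply/esym/residue_eq.
  set K := connected_component (i_boundary i X) (pt a o).
  have resX : is_residue (perp e i) X by exists (range (pt a)) => //; exists a.
  have KX : pi0 (i_boundary i X) K by exists (pt a o).
  have fK : f @` K = K := hol i X resX f stab K KX.
  have Kf : K (pt (chamber_map f a) o).
    rewrite -fK; exists (pt a o); last exact: chamber_mapE.
    exact: connected_component_refl.
  pose A := [set b : Gamma | Sub (link e i) (a^-1 * b)].
  have [l1 lM lV] := @special_subgroup_subgroup I e G (link e i).
  have Alink b h : A b -> Sub (link e i) h -> A (b * h).
    by rewrite /A /= mulgA; exact: lM.
  have AClink b h : (~` A) b -> Sub (link e i) h -> (~` A) (b * h).
    move=> nAb lh Abh; apply: nAb; have := lM _ _ Abh (lV _ lh).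
    by rewrite /A /= !mulgA mulgK.
  have KE : K `&` near_chambers i A = K.
    have Kconn : connected K by exact: component_connected.
    apply: Kconn.
    - exists (pt a o); split; first exact: connected_component_refl.
      apply/near_chambersP => //; split; first by rewrite /A /= mulVg.
      by move=> k _; rewrite originE ltr01.
    - by exists (near_chambers i A) => //; exact: near_chambers_open.
    - exists (~` near_chambers i (~` A)).
        by apply: open_closedC; exact: near_chambers_open.
      apply/seteqP; split=> p [Kp Ap]; split=> //.
        have [c [x pE]] := pt_surj p; rewrite pE in Ap *.
        by move/(near_chambersP _ _ Alink): Ap => [Ac _] /(near_chambersP _ _ AClink)[].
      have := connected_component_sub Kp; rewrite i_boundaryE => -[b [x [_ xL pE]]].
      have x1 k : k \notin link e i -> (coordinate x k < 1)%R by move=> /xL ->; exact: ltr01.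
      rewrite pE in Ap *; apply/near_chambersP => //; split=> //; apply: contrapT => nAb.
      by apply: Ap; apply/near_chambersP.
  have : near_chambers i A (pt (chamber_map f a) o) by move: Kf; rewrite -KE => -[].
  by move/(near_chambersP _ _ Alink) => -[].
move=> [p Yp <-]; set Y := i_boundary _ _ in Yp *.
(* Only an inclusion is proved for each [g]; applying it to [f] and to [f^-1] gives the equality. *)
have KK g : L g -> (forall q, Y q -> connected_component Y q (g q)) ->
    g @` connected_component Y p `<=` connected_component Y p.
  move=> Lg gY _ [q Kq <-]; apply: connected_component_trans (Kq) _; apply: gY.
  exact: connected_component_sub Kq.
have hY g q : L g ->
    g @` residue (perp e i) (range (pt a)) = residue (perp e i) (range (pt a)) ->
    Y q -> connected_component Y q (g q).
  move=> Lg; rewrite residue_image => /residue_eq ga.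
  rewrite {1}/Y i_boundaryE => -[b [x [ab xL ->]]].
  rewrite chamber_mapE -[chamber_map g b](mulVKg b); apply: boundary_component => //.
  apply: hol => //.
  have [J1 JM JV] := @special_subgroup_subgroup I e G (perp e i).
  have := JM _ _ (JV _ ab) (JM _ _ (JV _ ga) (chamber_map_special_eq g ab)).
  by rewrite !invgM !invgK -!mulgA !mulVKg.
apply/seteqP; split; first by apply: KK => // q; exact: hY.
move=> q Kq; exists (f^-1 q); last exact: aut_invK.
apply: KK (LV _ Lf) _ _ _; last by exists q.
move=> r; apply: hY; first exact: LV.
rewrite -[in LHS]fX; apply/seteqP; split=> [_ [_ [s sX <-] <-]|s sX].
  by rewrite -[X in _ X]/(aut_inv f (f s)) aut_funK.
by exists (f s); [exists s|exact: aut_funK].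
Qed.

End Holonomy.

(** * Labellings of the chambers *)

Section Labelling.
Variables (I : finType) (e : rel I) (G : I -> finGroupType).
Hypothesis e_sym : symmetric e.

Local Notation Gamma := (graph_product e G).
Local Notation gin := (@gp_in I e G _).
Local Notation Sub := (@special_subgroup I e G).
Implicit Types (a b h : Gamma).

(** The guiding example is [gp_coord], which has the three properties assumed next; the aim is to
    carry any such family to it by an automorphism. *)
Variable lab : forall i, Gamma -> G i.
Hypothesis lab_link : forall i a h, Sub (link e i) h -> lab i (a * h) = lab i a.
Hypothesis lab_surj : forall i a (k : G i), exists g : G i, lab i (a * gin g) = k.
Hypothesis lab_inj : forall i a (g g' : G i),
  lab i (a * gin g) = lab i (a * gin g') -> g = g'.

(** This is the substitute for right multiplication by [k]: the chamber of the panel of [a] whose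
    label is that of [a] times [k]. *)
Definition lab_step i a (k : G i) : Gamma :=
  a * gin (projT1 (cid (lab_surj a (lab i a * k)))).

Lemma lab_stepE i a (k : G i) : lab i (lab_step a k) = lab i a * k.
Proof. by rewrite /lab_step; case: cid. Qed.

Lemma lab_step_in i a (k : G i) : exists g : G i, lab_step a k = a * gin g.
Proof. by eexists. Qed.

Lemma lab_step_uniq i a (k g : G i) : lab i (a * gin g) = lab i a * k ->
  lab_step a k = a * gin g.
Proof.
have [g' sE] := lab_step_in a k.
by rewrite -lab_stepE sE => /lab_inj ->.
Qed.

Lemma lab_step1 i a : lab_step a (1 : G i) = a.
Proof.
by rewrite (@lab_step_uniq _ _ _ 1) gp_in1 !mulg1.
Qed.

Lemma lab_stepM i a (k l : G i) : lab_step a (k * l) = lab_step (lab_step a k) l.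
Proof.
have [g gE] := lab_step_in a k; have [g' g'E] := lab_step_in (lab_step a k) l.
rewrite g'E gE -mulgA -gp_inM; apply: lab_step_uniq.
by rewrite gp_inM mulgA -gE -g'E !lab_stepE mulgA.
Qed.

Lemma gp_in_link i j (g : G i) : i != j -> e i j -> Sub (link e j) (gin g).
Proof. by move=> ij eij; apply: special_in; rewrite inE ij e_sym. Qed.

(** A move in a panel of type [i] does not change the label of index [j], and conversely, so the
    same two commuting generators realize the moves in either order. *)
Lemma lab_stepC i j a (k : G i) (l : G j) : i != j -> e i j ->
  lab_step (lab_step a k) l = lab_step (lab_step a l) k.
Proof.
move=> ij eij; have ji : j != i by rewrite eq_sym.
have eji : e j i by rewrite e_sym.
have [g gE] := lab_step_in a k; have [g' g'E] := lab_step_in a l.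
have C : a * gin g * gin g' = a * gin g' * gin g.
  by rewrite -!mulgA (gp_in_commute g g' ij eij).
have labg b : lab j (b * gin g) = lab j b by apply: lab_link; exact: gp_in_link.
have labg' b : lab i (b * gin g') = lab i b by apply: lab_link; exact: gp_in_link.
rewrite gE g'E (@lab_step_uniq _ _ _ g'); last by rewrite C !labg -g'E lab_stepE.
by rewrite (@lab_step_uniq _ _ _ g) // -C !labg' -gE lab_stepE.
Qed.

Definition from_standard (x : Gamma) : Gamma := gp_act lab_step 1 x.

(** The first component walks through the chambers and the second accumulates the increments of the
    labels. As the steps satisfy the relations of Gamma, the accumulated product depends only on the
    endpoint. *)
Definition cocycle_step i (p : Gamma * Gamma) (g : G i) : Gamma * Gamma :=
  (p.1 * gin g, p.2 * gin ((lab i p.1)^-1 * lab i (p.1 * gin g))).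

Lemma cocycle_step1 i p : cocycle_step p (1 : G i) = p.
Proof. by case: p => a b; rewrite /cocycle_step /= gp_in1 mulg1 mulVg gp_in1 mulg1. Qed.

Lemma cocycle_stepM i p (g h : G i) :
  cocycle_step p (g * h) = cocycle_step (cocycle_step p g) h.
Proof.
rewrite /cocycle_step /= gp_inM mulgA -[p.2 * _ * _]mulgA -gp_inM.
by rewrite -[_^-1 * _ * (_ * _)]mulgA mulVKg.
Qed.

Lemma cocycle_stepC i j p (g : G i) (h : G j) : i != j -> e i j ->
  cocycle_step (cocycle_step p g) h = cocycle_step (cocycle_step p h) g.
Proof.
move=> ij eij; have ji : j != i by rewrite eq_sym.
have eji : e j i by rewrite e_sym.
have C : p.1 * gin g * gin h = p.1 * gin h * gin g.
  by rewrite -!mulgA (gp_in_commute g h ij eij).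
have labg b : lab j (b * gin g) = lab j b by apply: lab_link; exact: gp_in_link.
have labh b : lab i (b * gin h) = lab i b by apply: lab_link; exact: gp_in_link.
rewrite /cocycle_step /= -C; congr (_, _).
rewrite !labh (labg p.1) C labg -!mulgA.
by rewrite (gp_in_commute _ _ ij eij).
Qed.

Definition to_standard (a : Gamma) : Gamma := (gp_act cocycle_step (1, 1) a).2.

Lemma from_standard1 : from_standard 1 = 1.
Proof. exact: (gp_act1 lab_step1 lab_stepM lab_stepC). Qed.

Lemma from_standard_in x i (g : G i) :
  from_standard (x * gin g) = lab_step (from_standard x) g.
Proof. exact: (gp_act_in lab_step1 lab_stepM lab_stepC). Qed.

Lemma to_standard1 : to_standard 1 = 1.
Proof.
by rewrite /to_standard (gp_act1 cocycle_step1 cocycle_stepM cocycle_stepC).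
Qed.

Lemma to_standard_in a i (g : G i) :
  to_standard (a * gin g) = to_standard a * gin ((lab i a)^-1 * lab i (a * gin g)).
Proof.
have fstE x : (gp_act cocycle_step (1, 1) x).1 = x.
  move: x; apply: gp_ind => [|x j h IH].
    by rewrite (gp_act1 cocycle_step1 cocycle_stepM cocycle_stepC).
  by rewrite (gp_act_in cocycle_step1 cocycle_stepM cocycle_stepC) /= IH.
rewrite /to_standard (gp_act_in cocycle_step1 cocycle_stepM cocycle_stepC) /=.
by rewrite fstE.
Qed.

Lemma from_standardK : cancel from_standard to_standard.
Proof.
apply: gp_ind => [|x i g IH]; first by rewrite from_standard1 to_standard1.
rewrite from_standard_in; have [k kE] := lab_step_in (from_standard x) g.
by rewrite kE to_standard_in -kE lab_stepE mulKg IH.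
Qed.

Lemma to_standardK : cancel to_standard from_standard.
Proof.
apply: gp_ind => [|a i g IH]; first by rewrite to_standard1 from_standard1.
by rewrite to_standard_in from_standard_in IH (@lab_step_uniq _ _ _ g) // mulVKg.
Qed.

Lemma from_standard_adj x i (g : G i) :
  exists h : G i, from_standard (x * gin g) = from_standard x * gin h.
Proof. by rewrite from_standard_in; exact: lab_step_in. Qed.

Lemma to_standard_adj a i (g : G i) :
  exists h : G i, to_standard (a * gin g) = to_standard a * gin h.
Proof. by rewrite to_standard_in; eexists. Qed.

Variable R : realType.

Definition standardize : Aut0 R e G :=
  chamber_aut R to_standardK from_standardK to_standard_adj from_standard_adj.

(** Since [f] preserves labels, the conjugate preserves label increments, hence commutes with right
    multiplication by generators; such a map is left multiplication by its value at 1. *)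
Lemma standardize_conj (f : Aut0 R e G) :
    (forall i a, lab i (chamber_map f a) = lab i a) ->
  Gamma_in_Aut0 R e G (standardize * f * standardize^-1).
Proof.
move=> flab; pose F a := to_standard (chamber_map f (from_standard a)).
exists (F 1) => //; apply: aut_ext => x.
have stdE a : chamber_map standardize a = to_standard a by exact: chamber_map_aut.
have invE : chamber_map standardize^-1 x = from_standard x.
  by rewrite -[x in LHS]from_standardK -stdE chamber_mapK.
rewrite chamber_map_left !chamber_mapM invE stdE.
move: {invE} x; apply: gp_ind => [|x i g IH]; first by rewrite mulg1.
rewrite from_standard_in; have [k kE] := lab_step_in (from_standard x) g.
rewrite kE; have [l lE] := chamber_map_adj f (from_standard x) k.
by rewrite lE to_standard_in -lE !flab -kE lab_stepE mulKg -IH mulgA.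
Qed.

End Labelling.

(** * The labelling invariant under a group with trivial holonomy *)

Section InvariantLabelling.
Variables (R : realType) (I : finType) (e : rel I) (G : I -> finGroupType).

Local Notation Gamma := (graph_product e G).
Local Notation gin := (@gp_in I e G _).
Local Notation Sub := (@special_subgroup I e G).
Local Notation Aut := (@Aut0 R I e G).
Implicit Types (a b h : Gamma) (f : Aut).

Variable H : set Aut.
Hypothesis H_subgroup : is_subgroup H.
Hypothesis H_hol : forall f i a, H f ->
  Sub (perp e i) (a^-1 * chamber_map f a) -> Sub (link e i) (a^-1 * chamber_map f a).

(** One perp residue is chosen in each [H]-orbit; [orbit_repr_eq] shows that the choice depends on
    the orbit alone. The default 1 is never taken, as [a] itself is a candidate. *)
Definition orbit_repr i a : Gamma :=
  xget 1 [set b | exists2 f, H f & Sub (perp e i) (b^-1 * chamber_map f a)].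

Definition orbit_mover i a : Aut :=
  xget 1 [set f | H f /\ Sub (perp e i) ((orbit_repr i a)^-1 * chamber_map f a)].

Definition orbit_label i a : G i := gp_coord i (chamber_map (orbit_mover i a) a).

Lemma orbit_moverP i a : H (orbit_mover i a) /\
  Sub (perp e i) ((orbit_repr i a)^-1 * chamber_map (orbit_mover i a) a).
Proof.
have [H1 _ _] := H_subgroup; have [J1 _ _] := @special_subgroup_subgroup I e G (perp e i).
have [f Hf fa] : exists2 f, H f & Sub (perp e i) ((orbit_repr i a)^-1 * chamber_map f a).
  rewrite /orbit_repr; apply: (@xgetPex _ _
    [set b | exists2 f, H f & Sub (perp e i) (b^-1 * chamber_map f a)]).
  by exists a, 1; rewrite // chamber_map1 mulVg.
apply: (@xgetPex _ _
  [set f | H f /\ Sub (perp e i) ((orbit_repr i a)^-1 * chamber_map f a)]).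
by exists f.
Qed.

Lemma orbit_repr_eq i a b f : H f -> Sub (perp e i) (b^-1 * chamber_map f a) ->
  orbit_repr i b = orbit_repr i a.
Proof.
move=> Hf fab; have [_ HM HV] := H_subgroup.
have [_ JM JV] := @special_subgroup_subgroup I e G (perp e i).
congr (xget _ _); apply/seteqP; split=> c [g Hg gc].
  exists (g * f); first exact: HM.
  have := JM _ _ gc (chamber_map_special_eq g fab).
  by rewrite chamber_mapM -!mulgA mulVKg.
exists (g * f^-1); first by apply: HM => //; exact: HV.
have := JM _ _ gc (JV _ (chamber_map_special_eq (g * f^-1) fab)).
by rewrite -chamber_mapM mulgVK invgM invgK -!mulgA mulVKg.
Qed.

(** Two elements of [H] bringing [a] to the chosen residue differ by an element stabilizing it. By
    trivial holonomy the two images differ by an element of the link subgroup, whose coordinate of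
    index [i] is 1. *)
Lemma orbit_label_uniq i a f : H f ->
  Sub (perp e i) ((orbit_repr i a)^-1 * chamber_map f a) ->
  orbit_label i a = gp_coord i (chamber_map f a).
Proof.
move=> Hf fa; have [_ HM HV] := H_subgroup.
have [_ JM JV] := @special_subgroup_subgroup I e G (perp e i).
have [Hm ma] := orbit_moverP i a; rewrite /orbit_label; set m := orbit_mover i a in Hm ma *.
set b := chamber_map m a in ma *.
have fE : chamber_map f a = chamber_map (f * m^-1) b by rewrite -chamber_mapM mulgVK.
rewrite fE in fa *.
have Hfm : H (f * m^-1) by apply: HM => //; exact: HV.
have : Sub (link e i) (b^-1 * chamber_map (f * m^-1) b).
  apply: H_hol => //; have := JM _ _ (JV _ ma) fa.
  by rewrite invgM invgK -!mulgA mulVKg.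
move=> /(gp_coord_special (link_irr e i)) b1.
by rewrite -[chamber_map _ b](mulVKg b) gp_coordM b1 mulg1.
Qed.

Lemma orbit_label_invariant i a f : H f -> orbit_label i (chamber_map f a) = orbit_label i a.
Proof.
move=> Hf; have [_ HM HV] := H_subgroup; have [Hm ma] := orbit_moverP i a.
have [J1 _ _] := @special_subgroup_subgroup I e G (perp e i).
have mE : chamber_map (orbit_mover i a * f^-1) (chamber_map f a) =
    chamber_map (orbit_mover i a) a.
  by rewrite -chamber_mapM mulgVK.
rewrite (@orbit_label_uniq _ _ (orbit_mover i a * f^-1)) ?mE //.
  by apply: HM => //; exact: HV.
by rewrite (orbit_repr_eq (f := f) (a := a)) // mulVg.
Qed.

(** One mover serves all chambers of a residue, so on it the label is [gp_coord] transported by a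
    single automorphism. *)
Lemma orbit_label_perp i a h : Sub (perp e i) h ->
  orbit_label i (a * h) = gp_coord i (chamber_map (orbit_mover i a) (a * h)).
Proof.
move=> hP; have [H1 _ _] := H_subgroup; have [Hm ma] := orbit_moverP i a.
have [_ JM JV] := @special_subgroup_subgroup I e G (perp e i).
apply: orbit_label_uniq => //; rewrite (@orbit_repr_eq i a _ 1) //; last first.
  by rewrite chamber_map1 invgM mulgVK; exact: JV.
have := JM _ _ ma (chamber_map_special (orbit_mover i a) a hP).
by rewrite -!mulgA mulVKg.
Qed.

Lemma orbit_label_link i a h : Sub (link e i) h -> orbit_label i (a * h) = orbit_label i a.
Proof.
move=> hL; rewrite orbit_label_perp; last by apply: special_sub hL; exact: link_perp.
rewrite /orbit_label; set m := orbit_mover i a.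
have := chamber_map_special m a hL.
rewrite -[chamber_map m (a * h)](mulVKg (chamber_map m a)) mulKg.
by move=> /(gp_coord_special (link_irr e i)) h1; rewrite gp_coordM h1 mulg1.
Qed.

Lemma gin_perp i (g : G i) : Sub (perp e i) (gin g).
Proof. by apply: special_in; exact: perp_refl. Qed.

Lemma orbit_label_surj i a (k : G i) : exists g : G i, orbit_label i (a * gin g) = k.
Proof.
pose m := orbit_mover i a; pose b := chamber_map m a.
(* The chamber with coordinate [k] is found in the panel of [b] and pulled back by [m^-1]. *)
have [g gE] := chamber_map_adj m^-1 b ((gp_coord i b)^-1 * k).
exists g; rewrite orbit_label_perp; last exact: gin_perp.
rewrite -/m; rewrite [chamber_map _ b]chamber_mapK in gE.
by rewrite -gE chamber_mapVK gp_coord_mul_in mulVKg.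
Qed.

Lemma orbit_label_inj i a (g g' : G i) :
  orbit_label i (a * gin g) = orbit_label i (a * gin g') -> g = g'.
Proof.
rewrite !orbit_label_perp; try exact: gin_perp.
set m := orbit_mover i a.
have [h hE] := chamber_map_adj m a g; have [h' h'E] := chamber_map_adj m a g'.
rewrite hE h'E !gp_coord_mul_in => /mulgI hh; rewrite hh -h'E in hE.
by move/(can_inj (chamber_mapK m))/mulgI/gp_in_inj: hE.
Qed.

Lemma holonomy_free_conj : symmetric e ->
  exists g : Aut, conj_by g H `<=` Gamma_in_Aut0 R e G.
Proof.
move=> e_sym.
exists (standardize e_sym orbit_label_link orbit_label_surj orbit_label_inj R).
by move=> _ [f Hf <-]; apply: standardize_conj => i a; exact: orbit_label_invariant.
Qed.

End InvariantLabelling.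

(** * Commensurability *)

Section Commensurability.
Variables (R : realType) (I : finType) (e : rel I) (G : I -> finGroupType).

Local Notation Gamma := (graph_product e G).
Local Notation Sub := (@special_subgroup I e G).
Local Notation pt := (@pt R I e G).
Local Notation o := (@origin R I e).
Local Notation Aut := (@Aut0 R I e G).
Local Notation lattice := (Gamma_in_Aut0 R e G).
Implicit Types (f g : Aut) (a b c : Gamma).

Lemma left_autM a b : left_aut R (a * b) = left_aut R a * left_aut R b.
Proof. by apply: aut_ext => c; rewrite chamber_mapM !chamber_map_left mulgA. Qed.

Lemma left_aut1 : left_aut R (1 : Gamma) = 1.
Proof. by apply: aut_ext => c; rewrite chamber_map_left chamber_map1 mul1g. Qed.

Lemma left_autV a : left_aut R a^-1 = (left_aut R a)^-1.
Proof. by apply: (@mulgI _ (left_aut R a)); rewrite -left_autM !mulgV left_aut1. Qed.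

Lemma lattice_subgroup : is_subgroup lattice.
Proof.
split; first by exists 1; rewrite ?left_aut1.
- by move=> _ _ [a _ <-] [b _ <-]; exists (a * b); rewrite ?left_autM.
- by move=> _ [a _ <-]; exists a^-1; rewrite ?left_autV.
Qed.

Lemma finite_index_conj g (H L : set Aut) : is_subgroup H ->
  finite_index H L -> finite_index (conj_by g H) (conj_by g L).
Proof.
move=> Hsub [HL fin].
apply: (finite_index_fiber (tau := fun x => left_coset (g^-1 * x * g) H)).
- exact: conj_by_subgroup.
- by move=> _ [x /HL Lx <-]; exists x.
- apply: sub_finite_set fin => _ [_ [x Lx <-] <-]; exists x => //.
  by rewrite !mulgA mulVg mul1g mulgVK.
- move=> _ _ [x Lx <-] [y Ly <-] /(left_coset_eq Hsub).
  rewrite !mulgA mulVg !mul1g !mulgVK => Hxy; exists (x^-1 * y) => //.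
  by rewrite !invgM invgK !mulgA mulgVK.
Qed.

(* The kernel of Gamma -> prod_i G_i has trivial holonomy, although Gamma
   itself does not: G_i permutes the components of the i-boundary of a
   residue of type perp e i simply transitively. *)
Definition coordinate_kernel : set Aut :=
  [set f | exists2 c, f = left_aut R c & forall i, gp_coord i c = 1].

Lemma coordinate_kernel_subgroup : is_subgroup coordinate_kernel.
Proof.
split; first by exists 1; rewrite ?left_aut1 // => i; exact: gp_coord1.
- move=> _ _ [a -> a1] [b -> b1]; exists (a * b); rewrite ?left_autM // => i.
  by rewrite gp_coordM a1 b1 mulg1.
- move=> _ [a -> a1]; exists a^-1; rewrite ?left_autV // => i.
  by rewrite gp_coordV a1 invg1.
Qed.

(** Conjugated by [g], the element acts as left multiplication by some [c] with trivial coordinates,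
    which leaves the coordinates of [chamber_map g a] unchanged; [special_link] applies there, and
    [g^-1] brings the conclusion back. *)
Lemma conj_kernel_holonomy g (H : set Aut) : is_subgroup H ->
  conj_by g H `<=` coordinate_kernel -> trivial_holonomy H.
Proof.
move=> Hsub HK; apply/trivial_holonomy_chambers => // f i a Hf fa.
have [|c cE c1] := HK (g * f * g^-1); first by exists f.
have gfE : chamber_map g (chamber_map f a) = c * chamber_map g a.
  by rewrite -(@chamber_map_left R) -cE -!chamber_mapM mulgVK.
have ga := chamber_map_special_eq g fa; rewrite gfE in ga.
have gaL : Sub (link e i) ((chamber_map g a)^-1 * (c * chamber_map g a)).
  by apply: special_link => //; rewrite !gp_coordM gp_coordV c1 mul1g mulVg.
by have := chamber_map_special_eq g^-1 gaL; rewrite -gfE !chamber_mapK.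
Qed.

Lemma kernel_finite_index (L K : set Aut) : is_subgroup L -> L `<=` lattice ->
  finite_index L K -> is_subgroup K -> finite_index (K `&` coordinate_kernel) K.
Proof.
move=> Lsub Llat [LK fin] Ksub.
pose r (C : set Aut) : Aut := xget 1 C.
have rP x : L ((r (left_coset x L))^-1 * x).
  have [L1 LM LV] := Lsub.
  have [k Lk kE] : left_coset x L (r (left_coset x L)).
    by apply: xgetPex; exists x; exists 1; rewrite ?mulg1.
  by rewrite -kE invgM mulgVK; exact: LV.
(* The quotient of [x] by the chosen representative of its [L]-coset is a left multiplication; its
   value at the chamber 1 recovers the multiplier, whose coordinates take finitely many values. *)
pose tau x : set Aut * {dffun forall i, G i} := (left_coset x L,
  finfun (fun i => gp_coord i (chamber_map ((r (left_coset x L))^-1 * x) 1))).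
apply: (finite_index_fiber (tau := tau)).
- exact: subgroupI coordinate_kernel_subgroup.
- exact: subIsetl.
- apply: (@sub_finite_set _ _ ([set left_coset x L | x in K] `*` setT)).
    by move=> _ [x Kx <-]; split=> //; exists x.
  by apply: finite_setX => //; exact: finite_finset.
move=> x y Kx Ky [xy] /ffunP coordE; split.
  by have [_ KM KV] := Ksub; apply: KM => //; exact: KV.
have [c _ cE] := Llat _ (rP x); have [d _ dE] := Llat _ (rP y).
exists (c^-1 * d) => [|i].
  by rewrite left_autM left_autV cE dE xy invgM invgK -!mulgA mulVKg.
have := coordE i; rewrite !ffunE -cE -dE !chamber_map_left !mulg1 => cd.
by rewrite gp_coordM gp_coordV cd mulVg.
Qed.

(* Two elements x, y of Gamma are in the same coset as soon as x^-1 and y^-1,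
   seen as chambers, are in the same orbit. *)
Lemma cocompact_finite_index g (H L : set Aut) : is_subgroup H -> is_subgroup L ->
  finite_index H L -> finite_set [set orbit_of L p | p in @is_vertex R I e G] ->
  conj_by g H `<=` lattice -> finite_index (conj_by g H) lattice.
Proof.
move=> Hsub Lsub [HL finH] finL Hlat; have [L1 LM LV] := Lsub.
pose p (x : Aut) := (g^-1 * x^-1 : Aut) (pt 1 o).
pose base (O : set (building R e G)) := xget (pt 1 o) O.
pose mover x : Aut := xget 1 [set f | L f /\ f (base (orbit_of L (p x))) = p x].
have moverP x : L (mover x) /\ mover x (base (orbit_of L (p x))) = p x.
  apply: (@xgetPex _ _ [set f | L f /\ f (base (orbit_of L (p x))) = p x]).
  have [f Lf fE] : orbit_of L (p x) (base (orbit_of L (p x))).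
    by apply: xgetPex; exists (p x); exists 1.
  by exists f^-1; split; [exact: LV|rewrite -fE; exact: aut_funK].
(* There are finitely many [L]-orbits of vertices, and the coset of the inverse mover refines each
   of them into finitely many pieces, each inside one [H]-orbit. *)
pose tau x := (orbit_of L (p x), left_coset (mover x)^-1 H).
apply: (finite_index_fiber (tau := tau)) => //.
- exact: conj_by_subgroup.
- apply: (@sub_finite_set _ _ ([set orbit_of L p | p in @is_vertex R I e G] `*`
      [set left_coset x H | x in L])); last exact: finite_setX.
  move=> _ [x _ <-]; split.
    exists (p x) => //; exists finset.set0 => //.
    exists (chamber_map (g^-1 * x^-1) 1), o; split; first exact: origin_vertex.
    exact: chamber_mapE.
  by exists (mover x)^-1 => //; apply: LV; have [] := moverP x.
move=> _ _ [c _ <-] [d _ <-] [cd /(left_coset_eq Hsub)].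
set x := left_aut R c in cd *; set y := left_aut R d in cd *.
rewrite invgK; set k := _ * _ => Hk.
have [_ xE] := moverP x; have [_ yE] := moverP y.
have kE : k (p y) = p x.
  by rewrite -yE -xE cd -[LHS]/((mover x * (mover y)^-1 * mover y : Aut) _) mulgVK.
have [|m _ mE] := Hlat (g * k * g^-1); first by exists k.
(* The conjugate of [k] is left multiplication by some [m], and sending [d^-1] to [c^-1] forces [m]
   to be [c^-1 * d]. *)
have : chamber_map (g * k * g^-1) d^-1 = c^-1.
  have pE b : p (left_aut R b) = pt (chamber_map g^-1 b^-1) o.
    by rewrite /p -left_autV chamber_mapE chamber_mapM chamber_map_left mulg1.
  rewrite /x /y !pE chamber_mapE in kE; move/pt_inj_origin: kE => kE.
  by rewrite 2!chamber_mapM kE chamber_mapVK.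
rewrite -mE chamber_map_left => md.
exists k => //; rewrite -mE -[m](mulgK d^-1) md invgK left_autM left_autV //.
Qed.

End Commensurability.

Theorem theorem1p4 (R : realType) (I : finType) (e : rel I)
    (e_sym : symmetric e) (e_irr : irreflexive e)
    (G : I -> finGroupType) (Gamma' : set (Aut0 R e G))
    (Gamma'_lattice : uniform_lattice Gamma') :
  commensurable Gamma' (Gamma_in_Aut0 R e G) <->
  exists H : set (Aut0 R e G),
    [/\ is_subgroup H, finite_index H Gamma' & trivial_holonomy H].
Proof.
have [Lsub _ Lorbits] := Gamma'_lattice.
have latsub := lattice_subgroup R e G.
split=> [[g /= [finL _]]|[H [Hsub Hfin Hhol]]].
  have Lgsub := conj_by_subgroup g Lsub.
  have := kernel_finite_index (subgroupI Lgsub latsub) (@subIsetr _ _ _) finL Lgsub.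
  set N := _ `&` _ => finN.
  have Nsub : is_subgroup N by apply: subgroupI => //; exact: coordinate_kernel_subgroup.
  (* [N] is the part of the conjugate of [Gamma'] in the coordinate kernel; conjugating back gives a
     subgroup of [Gamma']. *)
  exists (conj_by g^-1 N).
  have conjK (K : set (Aut0 R e G)) h : conj_by h (conj_by h^-1 K) = K.
    apply/seteqP; split=> [_ [_ [x Kx <-] <-]|x Kx].
      by rewrite invgK !mulgA mulgV mul1g mulgK.
    exists (h^-1 * x * h); last by rewrite !mulgA mulgV mul1g mulgK.
    by exists x => //; rewrite invgK.
  split.
  - exact: conj_by_subgroup.
  - rewrite -[Gamma'](conjK _ g^-1) invgK; exact: finite_index_conj.
  - apply: (@conj_kernel_holonomy _ _ _ _ g); first exact: conj_by_subgroup.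
    by rewrite conjK; exact: subIsetr.
have [|g gH] := @holonomy_free_conj R I e G H Hsub _ e_sym.
  exact/trivial_holonomy_chambers.
have gHsub := conj_by_subgroup g Hsub.
have Lgsub := subgroupI (conj_by_subgroup g Lsub) latsub.
(* The conjugate of [H] lies in the intersection, so its finite index in both groups passes to the
   intersection. *)
have HL : conj_by g H `<=` conj_by g Gamma' `&` Gamma_in_Aut0 R e G.
  by move=> x Hx; split; [have [+ _] := finite_index_conj g Hsub Hfin; apply|exact: gH].
exists g; split.
  apply: (finite_index_mono gHsub Lgsub HL) => [x []|] //.
  exact: finite_index_conj.
apply: (finite_index_mono gHsub Lgsub HL) => [x []|] //.
exact: cocompact_finite_index Hfin Lorbits gH.
Qed.
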